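(* Let $\{\xi_k,k\ge1\}$ be i.i.d. real random variables with $\mathbb{E}(\xi_1)=0$ and $\mathrm{Var}(\xi_1)=1$, and let $\{W_{nk}: n\ge1,\ 1\le k\le n\}$ be an array of real random variables independent of $\{\xi_k\}$. Assume that, as $n\to\infty$, (A1) $\frac1n\sum_{k=1}^nW_{nk}^2\stackrel{P}{\longrightarrow}1$; (A2) $\max_{1\le k\le n}|W_{nk}|/\sqrt n\stackrel{P}{\longrightarrow}0$. Then $$\frac{1}{\sqrt n}\sum_{k=1}^nW_{nk}\xi_k\stackrel{d}{\longrightarrow}N(0,1).$$
   Context: The whole array $\{W_{nk}\}$ is independent of the whole sequence $\{\xi_k\}$; no independence or exchangeability among the weights $W_{nk}$ is assumed. $\stackrel{P}{\to}$ and $\stackrel{d}{\to}$ denote convergence in probability and in distribution. *)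

(* Defs.v *)
From HB Require Import structures.
From mathcomp Require Import all_boot all_order all_algebra.
From mathcomp Require Import finmap.
From mathcomp Require Import all_classical all_reals all_analysis.
From mathcomp Require Import measurable_realfun.

Set Implicit Arguments.
Unset Strict Implicit.
Unset Printing Implicit Defensive.

Import Order.TTheory GRing.Theory Num.Theory.
Import numFieldTopology.Exports.

Local Open Scope classical_set_scope.
Local Open Scope ring_scope.

Section Independence.
Context (d : measure_display) (T : measurableType d) (R : realType).
Variable P : probability T R.

Definition mutually_independent (I : choiceType) (X : I -> {RV P >-> R}) :=
  forall (J : {fset I}) (B : I -> set R), (forall i, measurable (B i)) ->
  P (\bigcap_(i in [set` J]) X i @^-1` B i) =
  (\prod_(i <- J) P (X i @^-1` B i))%E.

Definition identically_distributed (I : Type) (X : I -> {RV P >-> R}) :=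
  forall (i j : I) (B : set R), measurable B ->
  distribution P (X i) B = distribution P (X j) B.

Definition sigma_family (I : Type) (X : I -> {RV P >-> R}) : set (set T) :=
  <<s \bigcup_i preimage_set_system setT (X i) measurable >>.

Definition independent_families (I J : Type)
    (X : I -> {RV P >-> R}) (Y : J -> {RV P >-> R}) :=
  forall A B : set T, sigma_family X A -> sigma_family Y B ->
  P (A `&` B) = (P A * P B)%E.

End Independence.

Section Convergence.
Context (d : measure_display) (T : measurableType d) (R : realType).
Variable P : probability T R.

Definition cvg_in_probability (X : nat -> T -> R) (Y : T -> R) :=
  forall e : R, 0 < e ->
  P [set w | e < `|X n w - Y w|] @[n --> \oo] --> 0%E.

Definition cvg_in_distribution (X : nat -> {RV P >-> R})
    (Q : probability (measurableTypeR R) R) :=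
  forall r : R, {for r, continuous (fun t : R => Q `]-oo, t]%classic)} ->
  cdf (X n) r @[n --> \oo] --> Q `]-oo, r]%classic.

End Convergence.

Section WeightedSums.
Context (d : measure_display) (T : measurableType d) (R : realType).
Variable P : probability T R.

(* Columns and terms are 0-based: k here is index k + 1 in the usual
   1 <= k <= n convention, and row 0 is empty. *)
Variables (W : forall n : nat, 'I_n -> {RV P >-> R}) (xi : nat -> {RV P >-> R}).

Definition array_family (i : {n : nat & 'I_n}) : {RV P >-> R} :=
  W (tagged i).

Definition weighted_sum (n : nat) (w : T) : R :=
  (Num.sqrt n%:R)^-1 * \sum_(k < n) W k w * xi k w.

Let measurable_weighted_sum n : measurable_fun setT (weighted_sum n).
Proof.
apply: measurable_funM => //; apply: measurable_sum => k.
exact: measurable_funM.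
Qed.

HB.instance Definition _ n :=
  isMeasurableFun.Build _ _ T R (weighted_sum n) (measurable_weighted_sum n).

Definition weighted_sum_RV (n : nat) : {RV P >-> R} := weighted_sum n.

End WeightedSums.

(* Main.v *)
(* Lindeberg's replacement argument, run against the heat equation.  With [Phi]
   the standard normal cdf, [u v x = Phi ((r - x) / sqrt v)] solves
   [d_v u = d_x^2 u / 2].  Let the weights [a_j] of a row satisfy
   [max |a_j| <= e], and put [V_k = c + sum_(j >= k) a_j^2] and
   [S_k = sum_(j < k) a_j xi_j].  Since [xi_k] is independent of the weights and
   of the earlier [xi_j], the terms of order one and two cancel in the difference
   of the expectations of [u V_(k+1) S_(k+1)] and [u V_k S_k]: it is at most a
   constant times [E a_k^2 * (E (xi^2 min (e |xi|) 1) + e^2)].  Summing over [k],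
   [E Phi ((r - S_n) / sqrt c)] is close to [E Phi (r / sqrt (c + sum a_j^2))].
   Under (A1) and (A2), zeroing the rows with a large weight or with
   [sum a_j^2] far from 1 costs a vanishing probability, and
   [E Phi ((r - S_n) / sqrt c)] converges to [Phi (r / sqrt (1 + c))].
   A small [c] makes [Phi ((r - S_n) / sqrt c)] an approximate indicator of
   [S_n <= r]. *)

From HB Require Import structures.
Require Import Defs.
From mathcomp Require Import all_boot all_order all_algebra finmap.
From mathcomp Require Import all_classical all_reals all_analysis.
From mathcomp Require Import measurable_realfun ring lra.

Set Implicit Arguments.
Unset Strict Implicit.
Unset Printing Implicit Defensive.

Import Order.TTheory GRing.Theory Num.Theory.
Import numFieldTopology.Exports numFieldNormedType.Exports.

Local Open Scope classical_set_scope.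
Local Open Scope ring_scope.

(** * Taylor bounds *)

Section MeanValue.
Context (R : realType).
Implicit Types f df d2f : R -> R.

(** The segment is described by [Num.min] and [Num.max] so that increments of either sign are
    covered; by symmetry only [x <= y] has to be treated, where the mean value theorem applies. *)
Lemma ler_norm_MVT f df (x y M : R) :
  (forall t, Num.min x y <= t <= Num.max x y -> is_derive t 1 f (df t)) ->
  (forall t, Num.min x y <= t <= Num.max x y -> `|df t| <= M) ->
  `|f y - f x| <= M * `|y - x|.
Proof.
wlog xy : x y / x <= y => [H|].
  have /orP[xy|yx] := le_total x y; first exact: H.
  by rewrite minC maxC distrC (distrC y x); exact: H.
rewrite (min_idPl xy) (max_idPr xy) => fdf dfM.
have fc : {within `[x, y], continuous f}.
  apply: derivable_within_continuous => t; rewrite in_itv => /fdf td.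
  exact: ex_derive.
have fd t : t \in `]x, y[ -> is_derive t 1 f (df t).
  by rewrite in_itv /= => /andP[/ltW ? /ltW ?]; apply: fdf; apply/andP.
have [t] := MVT_segment xy fd fc.
rewrite in_itv /= => txy ->; rewrite normrM ler_wpM2r//; exact: dfM.
Qed.

(** Two applications of the mean value bound: [g] is [f] minus its quadratic Taylor polynomial, [dg]
    is its derivative, and the derivative of [dg] is an increment of [d2f], bounded by [M]. Only the
    oscillation of [d2f] enters, so no third derivative appears. *)
Lemma taylor2_bound f df d2f (x h M : R) :
  (forall t : R, is_derive t 1 f (df t)) ->
  (forall t : R, is_derive t 1 df (d2f t)) ->
  (forall t, `|t| <= `|h| -> `|d2f (x + t) - d2f x| <= M) ->
  `|f (x + h) - f x - h * df x - h ^+ 2 * d2f x / 2| <= M * h ^+ 2.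
Proof.
move=> fdf dfd2f d2fM.
have key (t : R) : Num.min 0 h <= t <= Num.max 0 h -> `|t| <= `|h|.
  by case: (leP 0 h) => h0 /andP[t1 t2]; [rewrite !ger0_norm //|
    rewrite !ler0_norm ?lerN2 // ltW].
pose g (t : R) := f (x + t) - t * df x - t ^+ 2 * (d2f x / 2).
pose dg (t : R) := df (x + t) - df x - t * d2f x.
have dgM (t : R) : Num.min 0 h <= t <= Num.max 0 h -> `|dg t| <= M * `|h|.
  move=> /key th.
  have M0 : 0 <= M by apply: le_trans (d2fM 0 _); rewrite ?normr0.
  apply: (@le_trans _ _ (M * `|t|)); last exact: ler_wpM2l.
  pose k (s : R) := df (x + s) - s * d2f x.
  have -> : dg t = k t - k 0 by rewrite /dg /k addr0 mul0r subr0 addrAC.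
  rewrite -[X in M * `|X|](subr0 t).
  apply: (@ler_norm_MVT _ (fun s => d2f (x + s) - d2f x)) => s sht.
    rewrite /k; apply: is_deriveB.
      have := is_derive1_comp (dfd2f (x + s))
        (is_deriveD (is_derive_cst x s 1) (is_derive_id s 1)).
      by rewrite add0r mulr1.
    have := is_deriveM (is_derive_id s 1) (is_derive_cst (d2f x) s 1).
    by move=> /is_derive_eq; apply; rewrite scaler0 add0r /GRing.scale /= mulr1.
  apply: d2fM; apply: le_trans th.
  by move: sht; case: (leP 0 t) => t0 /andP[t1 t2]; [rewrite !ger0_norm //|
    rewrite !ler0_norm ?lerN2 // ltW].
have -> : f (x + h) - f x - h * df x - h ^+ 2 * d2f x / 2 = g h - g 0.
  by rewrite /g addr0 expr0n /= !mul0r !subr0; ring.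
rewrite -(real_normK (num_real h)) expr2 mulrA -[X in _ * `|X|](subr0 h).
apply: (@ler_norm_MVT _ dg) => // s _.
rewrite /g /dg; apply: is_deriveB.
  apply: is_deriveB.
    have := is_derive1_comp (fdf (x + s))
        (is_deriveD (is_derive_cst x s 1) (is_derive_id s 1)).
      by rewrite add0r mulr1.
  have := is_deriveM (is_derive_id s 1) (is_derive_cst (df x) s 1).
  by move=> /is_derive_eq; apply; rewrite scaler0 add0r /GRing.scale /= mulr1.
have := is_deriveM (is_deriveX 2 (is_derive_id s 1)) (is_derive_cst (d2f x / 2) s 1).
move=> /is_derive_eq; apply; rewrite scaler0 add0r /GRing.scale /=.
by rewrite expr1 mulr1 /GRing.scale /=; field.
Qed.

End MeanValue.

(** * The normal cdf and the heat equation *)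

Section NormalCdf.
Context (R : realType).
Implicit Types x y z v h c p : R.

Definition Phi x : R := fine (normal_prob 0 1 `]-oo, x]).
Definition phi (x : R) : R := normal_pdf 0 1 x.

Lemma phiE x : phi x = normal_peak 1 * expR (- x ^+ 2 / 2).
Proof.
by rewrite /phi normal_pdfE ?oner_neq0// /normal_fun subr0 expr1n.
Qed.

Lemma normal_peak1_le1 : normal_peak (1 : R) <= 1.
Proof.
have h : 1 <= pi *+ 2 :> R.
  rewrite (@le_trans _ _ (2 *+ 2))//; first by rewrite -mulrnA ler1n.
  by rewrite lerMn2r/= pi_ge2.
rewrite /normal_peak expr1n mul1r invf_le1 ?sqrtr_gt0 ?(lt_le_trans _ h)//.
by rewrite -[leLHS]sqrtr1 ler_wsqrtr.
Qed.

Lemma normal_prob_rayE x : normal_prob 0 1 `]-oo, x] = (Phi x)%:E.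
Proof. by rewrite /Phi fineK// fin_num_measure. Qed.

Lemma is_derive_Phi x : is_derive x 1 Phi (phi x).
Proof.
have [d e] : derivable Phi x 1 /\ derive1 Phi x = phi x.
  (* The fundamental theorem of calculus on a left-unbounded ray; [x + 1] is an arbitrary point to
     the right of [x]. *)
  apply: (@continuous_FTC1 _ phi -oo%O x (x + 1)); rewrite ?ltrDl//.
    by apply: integrableS (integrable_normal_pdf 0 1).
    by rewrite ltNyr.
  by apply: (@continuous_normal_pdf R 0 1); exact: oner_neq0.
by rewrite -e derive1E; exact: derivableP.
Qed.

Lemma is_derive_phi x : is_derive x 1 phi (- x * phi x).
Proof.
have -> : phi = fun t => normal_peak 1 * expR (t ^+ 2 * - 2^-1).
  by apply/funext => t; rewrite phiE mulrN mulNr.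
have dg := is_deriveM (is_deriveX 2 (is_derive_id x 1)) (is_derive_cst (- 2^-1 : R) x 1).
have dh := is_deriveM (is_derive_cst (normal_peak 1 : R) x 1)
  (is_derive1_comp (is_derive_expR _) dg).
apply: (is_derive_eq dh).
by rewrite /GRing.scale /= /cst /= !expr1 /GRing.scale /=; field.
Qed.

Lemma Phi01 x : 0 <= Phi x <= 1.
Proof.
by rewrite -!lee_fin -normal_prob_rayE measure_ge0 probability_le1.
Qed.

(** [expR (x ^+ 2 / 2)] is the square of [expR (x ^+ 2 / 4)], which is at least [1 + x ^+ 2 / 4].
    This quartic weight dominates every polynomial factor occurring in the derivatives below. *)
Lemma phi_decay x : phi x * (1 + x ^+ 2 / 4) ^+ 2 <= 1.
Proof.
have p0 := normal_peak_ge0 (1 : R).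
rewrite phiE -mulrA; apply: (le_trans _ normal_peak1_le1).
rewrite ler_piMr//.
have -> : - x ^+ 2 / 2 = - (x ^+ 2 / 4 * 2) by field.
rewrite expRN expRM_natr ler_pdivrMl ?exprn_gt0 ?expR_gt0// mulr1.
by rewrite lerXn2r ?nnegrE ?expR_ge0 ?expR_ge1Dx//; have := sqr_ge0 x; lra.
Qed.

(** The second derivative of [Phi]. *)
Definition phi2 (x : R) : R := - x * phi x.

Lemma phi_ge0 x : 0 <= phi x. Proof. exact: normal_pdf_ge0. Qed.

(** Reduces a bound on a polynomial times the density to a polynomial inequality. *)
Lemma normr_phiM_le p c x : `|p| <= c * (1 + x ^+ 2 / 4) ^+ 2 -> `|p * phi x| <= c.
Proof.
move=> pc; rewrite normrM (ger0_norm (phi_ge0 x)).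
apply: (le_trans (ler_wpM2r (phi_ge0 x) pc)).
rewrite -mulrA [X in _ * X]mulrC ler_piMr ?phi_decay//.
have := le_trans (normr_ge0 _) pc; rewrite pmulr_lge0//.
by rewrite exprn_gt0// ltr_wpDr// mulr_ge0// sqr_ge0.
Qed.

Lemma normr_le_1Dsqr x : `|x| <= 1 + x ^+ 2 / 4.
Proof. by rewrite -(real_normK (num_real x)); have := sqr_ge0 (`|x| / 2 - 1); nra. Qed.

Lemma phi_le1 x : `|phi x| <= 1.
Proof.
rewrite -[phi x]mul1r; apply: normr_phiM_le; rewrite normr1 mul1r.
by have := sqr_ge0 x; nra.
Qed.

Lemma phi2_le1 x : `|phi2 x| <= 1.
Proof.
apply: normr_phiM_le; rewrite normrN mul1r; apply: (le_trans (normr_le_1Dsqr x)).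
by have := sqr_ge0 x; nra.
Qed.

Lemma is_derive_phi2 x : is_derive x 1 phi2 ((x ^+ 2 - 1) * phi x).
Proof.
have := is_deriveM (is_deriveN (is_derive_id x 1)) (is_derive_phi x).
move=> /is_derive_eq; apply.
by change (- x * (- x * phi x) + phi x * -1 = (x ^+ 2 - 1) * phi x); ring.
Qed.

Lemma normr_sqrB1_le x : `|x ^+ 2 - 1| <= 4 * (1 + x ^+ 2 / 4).
Proof. by have := sqr_ge0 x; rewrite ler_norml => ?; apply/andP; split; lra. Qed.

Lemma dphi2_le4 x : `|(x ^+ 2 - 1) * phi x| <= 4.
Proof.
apply: normr_phiM_le; apply: (le_trans (normr_sqrB1_le x)).
by have := sqr_ge0 x; nra.
Qed.

Lemma Mdphi2_le4 x : `|x * ((x ^+ 2 - 1) * phi x)| <= 4.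
Proof.
rewrite mulrA; apply: normr_phiM_le; rewrite normrM.
apply: (le_trans (ler_pM _ _ (normr_le_1Dsqr x) (normr_sqrB1_le x))) => //.
by rewrite mulrCA expr2.
Qed.

(** Close points use the bound on the derivative of [phi2], distant points the bound on [phi2]
    itself. *)
Lemma phi2_lip x y : `|phi2 y - phi2 x| <= 4 * Num.min `|y - x| 1.
Proof.
have [_|_] := leP `|y - x| 1.
  apply: (@ler_norm_MVT _ _ (fun t => (t ^+ 2 - 1) * phi t)) => t _.
    exact: is_derive_phi2.
  exact: dphi2_le4.
rewrite mulr1; apply: (le_trans (ler_normB _ _)).
by have := phi2_le1 x; have := phi2_le1 y; lra.
Qed.

(** The remainder is cubic for small [h] but only quadratic for large [h], so that its expectation
    is controlled by second moments alone. *)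
Lemma Phi_taylor x h :
  `|Phi (x + h) - Phi x - h * phi x - h ^+ 2 * phi2 x / 2|
    <= 4 * Num.min `|h| 1 * h ^+ 2.
Proof.
apply: taylor2_bound => [t|t|t th].
- exact: is_derive_Phi.
- exact: is_derive_phi.
apply: (le_trans (phi2_lip _ _)).
by rewrite addrAC subrr add0r ler_pM2l// le_min !ge_min th lexx orbT.
Qed.

Lemma Phi_lip x y : `|Phi y - Phi x| <= `|y - x|.
Proof.
rewrite -[leRHS]mul1r; apply: (@ler_norm_MVT _ _ phi) => t _.
  exact: is_derive_Phi.
exact: phi_le1.
Qed.

(** The inverse standard deviation, written as a real power so that its derivative and measurability
    come from those of powers. *)
Definition isqrt (v : R) : R := v `^ (- 2^-1).

Lemma isqrt_gt0 v : 0 < v -> 0 < isqrt v. Proof. exact: powR_gt0. Qed.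

Lemma isqrt_sqr v : 0 < v -> isqrt v ^+ 2 = v^-1.
Proof.
move=> v0; rewrite /isqrt -powR_mulrn ?powR_ge0// -powRrM.
by rewrite mulNr mulVf// powR_inv1// ltW.
Qed.

Lemma is_derive_isqrt v : 0 < v -> is_derive v 1 isqrt (- isqrt v ^+ 3 / 2).
Proof.
move=> v0; apply: (is_derive_eq (is_derive1_powR _ v0)).
have vn : v != 0 by rewrite gt_eqF.
rewrite exprS isqrt_sqr// powRB ?vn ?implybT// powRr1 ?(ltW v0)// -/(isqrt v).
by field.
Qed.

(* [heat (r - x) v] is [u v x]; [dheat] is both its derivative in [v] and half of
   its second derivative in [x]. *)
Definition heat (y v : R) : R := Phi (y * isqrt v).
Definition dheat (y v : R) : R := isqrt v ^+ 2 * phi2 (y * isqrt v) / 2.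

Lemma is_derive_scale_isqrt y v : 0 < v ->
  is_derive v 1 (fun t => y * isqrt t) (- (y * isqrt v ^+ 3) / 2).
Proof.
move=> v0.
have := is_deriveM (is_derive_cst y v 1) (is_derive_isqrt v0).
move=> /is_derive_eq; apply.
change (y * (- isqrt v ^+ 3 / 2) + isqrt v * 0 = - (y * isqrt v ^+ 3) / 2).
by field.
Qed.

Lemma is_derive_heat y v : 0 < v -> is_derive v 1 (heat y) (dheat y v).
Proof.
move=> v0.
have := @is_derive1_comp _ Phi (fun t => y * isqrt t) _ _ _
  (is_derive_Phi (y * isqrt v)) (is_derive_scale_isqrt y v0).
by move=> /is_derive_eq; apply; rewrite /dheat /phi2; field.
Qed.

(** The derivative is arranged as [v ^- 2] times a function of [z] alone, whose pieces are the ones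
    bounded by [Mdphi2_le4] and [phi2_le1]. *)
Lemma is_derive_dheat y v (z := y * isqrt v) : 0 < v ->
  is_derive v 1 (dheat y)
    (- (isqrt v ^+ 2) ^+ 2 * (z * ((z ^+ 2 - 1) * phi z) / 4 + phi2 z / 2)).
Proof.
move=> v0.
have d1 := @is_derive1_comp _ phi2 (fun t => y * isqrt t) _ _ _
  (is_derive_phi2 z) (is_derive_scale_isqrt y v0).
have d2 := is_deriveX 2 (is_derive_isqrt v0).
have d3 := is_deriveM (is_deriveM d2 d1) (is_derive_cst (2^-1 : R) v 1).
apply: (is_derive_eq d3).
change (isqrt v ^+ 2 * phi2 z * 0 + 2^-1 *
  (isqrt v ^+ 2 * ((z ^+ 2 - 1) * phi z * (- (y * isqrt v ^+ 3) / 2)) +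
   phi2 z * (2 * isqrt v ^+ 1 * (- isqrt v ^+ 3 / 2))) =
  - (isqrt v ^+ 2) ^+ 2 * (z * ((z ^+ 2 - 1) * phi z) / 4 + phi2 z / 2)).
by rewrite /z; field.
Qed.

Lemma dheat_le y c v : 0 < c -> c <= v -> `|dheat y v| <= c^-1.
Proof.
move=> c0 cv; have v0 := lt_le_trans c0 cv.
have vc : v^-1 <= c^-1 by rewrite lef_pV2 ?posrE.
have vi : 0 <= v^-1 by rewrite invr_ge0 ltW.
rewrite /dheat isqrt_sqr// -mulrA normrM (ger0_norm vi) -[leRHS]mulr1.
apply: ler_pM => //; rewrite normrM normfV (ger0_norm (ler0n _ 2)).
by have := phi2_le1 (y * isqrt v); lra.
Qed.

(** The bracket is at most [4 / 4 + 1 / 2], rounded up to [2]; the prefactor is [v ^- 2]. *)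
Lemma ddheat_le c v z : 0 < c -> c <= v ->
  `|- (isqrt v ^+ 2) ^+ 2 * (z * ((z ^+ 2 - 1) * phi z) / 4 + phi2 z / 2)|
    <= 2 * c^-1 ^+ 2.
Proof.
move=> c0 cv; have v0 := lt_le_trans c0 cv.
rewrite isqrt_sqr// mulNr normrN normrM ger0_norm ?sqr_ge0// mulrC.
apply: ler_pM => //; first exact: sqr_ge0.
  have := Mdphi2_le4 z; have := phi2_le1 z; rewrite !ler_norml.
  by move=> /andP[? ?] /andP[? ?]; apply/andP; split; lra.
by rewrite lerXn2r ?nnegrE ?invr_ge0 ?(ltW v0) ?(ltW c0)// lef_pV2 ?posrE.
Qed.

Lemma heat_lip y c v v' : 0 < c -> c <= v -> c <= v' ->
  `|heat y v' - heat y v| <= c^-1 * `|v' - v|.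
Proof.
move=> c0 cv cv'; apply: (@ler_norm_MVT _ _ (dheat y)) => t /andP[t1 _].
all: have ct : c <= t by apply: le_trans t1; rewrite le_min cv.
  by apply: is_derive_heat; apply: lt_le_trans ct.
exact: dheat_le.
Qed.

(** A first-order expansion in the variance suffices, since the increment used later is [a ^+ 2],
    already of second order in the weight. The mean value bound is applied to [heat] minus its
    tangent, then to the increment of [dheat]. *)
Lemma heat_taylor y c v h : 0 < c -> c <= v -> 0 <= h ->
  `|heat y (v + h) - heat y v - h * dheat y v| <= 2 * c^-1 ^+ 2 * h ^+ 2.
Proof.
move=> c0 cv h0; have vh : v <= v + h by rewrite lerDl.
pose g t := heat y t - t * dheat y v.
have -> : heat y (v + h) - heat y v - h * dheat y v = g (v + h) - g v.
  by rewrite /g; move: (heat y (v + h)) (heat y v) (dheat y v) => ? ? ?; ring.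
rewrite [X in _ * X]expr2 mulrA -[X in _ * X](ger0_norm h0).
rewrite -[X in _ * `|X|](addKr v h) [- v + _]addrC.
apply: (@ler_norm_MVT _ _ (fun t => dheat y t - dheat y v)) => t.
all: rewrite (min_idPl vh) (max_idPr vh) => /andP[vt tvh].
all: have v0 := lt_le_trans c0 cv.
all: have t0 := lt_le_trans v0 vt.
  apply: is_deriveB; first exact: is_derive_heat.
  have := is_deriveM (is_derive_id t 1) (is_derive_cst (dheat y v) t 1).
  by move=> /is_derive_eq; apply; rewrite scaler0 add0r /GRing.scale /= mulr1.
apply: (@le_trans _ _ (2 * c^-1 ^+ 2 * `|t - v|)); last first.
  by rewrite ler_wpM2l ?mulr_ge0 ?invr_ge0 ?(ltW c0)// ger0_norm ?subr_ge0// lerBlDl.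
apply: (@ler_norm_MVT _ _ (fun v => let z := y * isqrt v in
  (- (isqrt v ^+ 2) ^+ 2 * (z * ((z ^+ 2 - 1) * phi z) / 4 + phi2 z / 2)))) => s.
all: rewrite (min_idPl vt) (max_idPr vt) => /andP[vs st].
  by apply: is_derive_dheat; apply: lt_le_trans vs.
by apply: ddheat_le => //; exact: le_trans vs.
Qed.

End NormalCdf.

(** * Products of independent factors *)

Section Independence.
Context d d' (T : measurableType d) (T' : measurableType d') (R : realType).
Variables (P : probability T R) (X : {mfun T >-> T'}) (Y : {RV P >-> R}).

(** Independence says that the joint law of [X] and [Y] agrees with the product of their laws on
    rectangles, hence everywhere; Fubini then factors the integral. The target of [X] is an
    arbitrary measurable space so that [X] can later carry the whole past. *)
Lemma Rintegral_indepM (H : T' -> R) (g : R -> R) (M : R) :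
  (forall A B, measurable A -> measurable B ->
    P (X @^-1` A `&` Y @^-1` B) = (P (X @^-1` A) * P (Y @^-1` B))%E) ->
  measurable_fun setT H -> (forall x, `|H x| <= M) ->
  measurable_fun setT g -> P.-integrable setT (EFin \o (g \o Y)) ->
  \int[P]_w (H (X w) * g (Y w)) = \int[P]_w H (X w) * \int[P]_w g (Y w).
Proof.
move=> indep mH HM mg ig.
have mZ : measurable_fun setT (fun w => (X w, Y w)).
  exact: measurable_fun_pair.
pose Z : {mfun T >-> (T' * R)%type} := HB.pack (fun w => (X w, Y w))
  (isMeasurableFun.Build _ _ _ _ _ mZ).
pose f (z : T' * R) : R := H z.1 * g z.2.
have mf : measurable_fun setT f.
  by apply: measurable_funM; apply: measurableT_comp.
have PZ A : measurable A ->
    (distribution P X \x distribution P Y)%E A = distribution P Z A.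
  apply: product_measure_unique => B C mB mC /=.
  by rewrite /distribution /pushforward -indep.
have iH : P.-integrable setT (EFin \o (H \o X)).
  apply: (@le_integrable _ _ _ _ _ _ _ (EFin \o cst M)) => //.
  - by apply/measurable_EFinP; exact: measurableT_comp.
  - move=> w _; rewrite /= lee_fin (le_trans (HM _))// ler_norm//.
  - exact: finite_measure_integrable_cst.
have iHg : P.-integrable setT (EFin \o (f \o Z)).
  apply: (@le_integrable _ _ _ _ _ _ _ (EFin \o (fun w => M * g (Y w)))) => //.
  - by apply/measurable_EFinP; exact: measurableT_comp.
  - move=> w _; rewrite /= lee_fin /f/= !normrM ler_wpM2r// (le_trans (HM _))//.
    by rewrite ler_norm.
  - exact: (integrableZl measurableT M ig).
have if2 : (distribution P X \x distribution P Y)%E.-integrable setT (EFin \o f).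
  apply/integrableP; split; first exact/measurable_EFinP.
  rewrite (eq_measure_integral (distribution P Z)); last by move=> A mA _; exact: PZ.
  have /integrableP[] // : (distribution P Z).-integrable setT (EFin \o f).
  by apply: integrable_pushforward => //; exact/measurable_EFinP.
(* Pass to the joint law, replace it by the product law, and integrate in [Y] first. *)
transitivity (fine (\int[distribution P Z]_z (f z)%:E)).
  by rewrite integral_distribution//; exact/measurable_EFinP.
rewrite (eq_measure_integral (distribution P X \x distribution P Y)%E); last first.
  by move=> A mA _; exact/esym/PZ.
rewrite -integral12_prod_meas1//=.
have ig' : (distribution P Y).-integrable setT (EFin \o g).
  by apply: integrable_pushforward => //; exact/measurable_EFinP.
transitivity (fine (\int[distribution P X]_x (H x * \int[P]_w g (Y w))%:E)).
  congr fine; apply: eq_integral => x _.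
  rewrite /fubini_F. under eq_integral do rewrite /f/= EFinM.
  rewrite [RHS]EFinM.
  rewrite integralZl//; congr (_ * _)%E.
  rewrite integral_distribution//; last exact/measurable_EFinP.
  rewrite fineK//; exact: integrable_fin_num.
rewrite integral_distribution//=.
- by rewrite -RintegralZr.
- by apply/measurable_EFinP; exact: measurable_funM.
  exact: (integrableZr measurableT (\int[P]_w g (Y w)) iH).
Qed.

End Independence.

(** * Pointwise expansion of one replacement *)

Section Step.
Context (R : realType).
Implicit Types y v a c e x : R.

(** For [c <= 1] the inverse square root of [c] is at most [c^-1], which keeps all later constants
    integer powers of [c^-1]. *)
Lemma isqrt_le c v : 0 < c -> c <= 1 -> c <= v -> isqrt v <= c^-1.
Proof.
move=> c0 c1 cv; have v0 := lt_le_trans c0 cv.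
have ci : 1 <= c^-1 by rewrite invf_ge1.
have q0 := isqrt_gt0 v0.
rewrite -(@ler_pXn2r _ 2) ?nnegrE ?(ltW q0) ?invr_ge0 ?(ltW c0)//.
rewrite isqrt_sqr//; apply: (@le_trans _ _ c^-1); first by rewrite lef_pV2 ?posrE.
by rewrite expr2 ler_peMr// invr_ge0 ltW.
Qed.

(** Expand in space by [Phi_taylor] and in variance by [heat_taylor]. By the heat equation both
    expansions have the coefficient [a ^+ 2 * dheat y v], once with [x ^+ 2] and once with [1];
    hence the factor [x ^+ 2 - 1]. Both subtracted terms are centered when [x] is a standardized
    variable. *)
Lemma heat_step y v a x c e : 0 < c -> c <= 1 -> c <= v -> `|a| <= e ->
  `|heat (y - a * x) v - heat y (v + a ^+ 2)
    - - (a * isqrt v * phi (y * isqrt v)) * x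
    - a ^+ 2 * dheat y v * (x ^+ 2 - 1)|
  <= 4 * c^-1 ^+ 2 * (a ^+ 2 * (x ^+ 2 * Num.min (e * `|x|) 1 + e ^+ 2)).
Proof.
move=> c0 c1 cv ae; have v0 := lt_le_trans c0 cv.
have ci : 1 <= c^-1 by rewrite invf_ge1.
have q0 := isqrt_gt0 v0.
have qc := isqrt_le c0 c1 cv.
have e0 : 0 <= e := le_trans (normr_ge0 a) ae.
have a2 : a ^+ 2 <= e ^+ 2 by rewrite -(real_normK (num_real a)) lerXn2r ?nnegrE.
have := heat_taylor y c0 cv (sqr_ge0 a).
have := Phi_taylor (y * isqrt v) (- (a * x * isqrt v)).
(* The displacement of the argument of [Phi] when [y] moves to [y - a * x]. *)
set h := - (a * x * isqrt v).
have -> : y * isqrt v + h = (y - a * x) * isqrt v by rewrite /h; ring.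
rewrite -/(heat y v) -/(heat (y - a * x) v).
have -> : h ^+ 2 * phi2 (y * isqrt v) / 2 = x ^+ 2 * (a ^+ 2 * dheat y v).
  rewrite /h /dheat; move: (phi2 _) => p; ring.
have hx : `|h| <= c^-1 * (e * `|x|).
  rewrite /h normrN !normrM (gtr0_norm q0) mulrC ler_pM ?(ltW q0)//.
  by rewrite ler_wpM2r.
have hm : Num.min `|h| 1 <= c^-1 * Num.min (e * `|x|) 1.
  have [_|_] := leP (e * `|x|) 1; first by rewrite ge_min hx.
  by rewrite mulr1 ge_min ci orbT.
have h2 : h ^+ 2 <= c^-1 * (a ^+ 2 * x ^+ 2).
  rewrite /h sqrrN !exprMn isqrt_sqr// mulrC.
  apply: ler_wpM2r; first by rewrite mulr_ge0 ?sqr_ge0.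
  by rewrite lef_pV2 ?posrE.
have hh : Num.min `|h| 1 * h ^+ 2 <=
    c^-1 ^+ 2 * (a ^+ 2 * (x ^+ 2 * Num.min (e * `|x|) 1)).
  have -> : c^-1 ^+ 2 * (a ^+ 2 * (x ^+ 2 * Num.min (e * `|x|) 1)) =
    c^-1 * Num.min (e * `|x|) 1 * (c^-1 * (a ^+ 2 * x ^+ 2)) by ring.
  by apply: ler_pM => //; rewrite ?sqr_ge0// le_min normr_ge0 ler01.
have haa : c^-1 ^+ 2 * (a ^+ 2) ^+ 2 <= c^-1 ^+ 2 * (a ^+ 2 * e ^+ 2).
  by rewrite ler_wpM2l ?sqr_ge0// expr2 ler_wpM2l ?sqr_ge0.
have -> : h * phi (y * isqrt v) = - (a * isqrt v * phi (y * isqrt v)) * x.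
  by rewrite /h; ring.
move: (heat _ _) (heat _ _) (heat _ _) (dheat _ _) (phi _) => A B C D E.
move: (Num.min `|h| 1) (Num.min (e * `|x|) 1) hh {hm h2 hx} => m m' hh.
rewrite !ler_norml => /andP[? ?] /andP[? ?].
rewrite mulrDr mulrDr; apply/andP; split; nra.
Qed.

End Step.

(** * One Lindeberg step *)

Section Measurability.
Context d (T : measurableType d) (R : realType).
Implicit Types f g : T -> R.

Lemma measurable_is_derive (h dh : R -> R) :
  (forall t : R, is_derive t 1 h (dh t)) -> measurable_fun setT h.
Proof.
move=> hd; apply: continuous_measurable_fun => t.
by apply: differentiable_continuous; apply/derivable1_diffP; exact: ex_derive.
Qed.

Lemma measurable_Phi : measurable_fun setT (@Phi R).
Proof. exact: measurable_is_derive (@is_derive_Phi R). Qed.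

Lemma measurable_phi : measurable_fun setT (@phi R).
Proof. exact: measurable_is_derive (@is_derive_phi R). Qed.

Lemma measurable_isqrt : measurable_fun setT (@isqrt R).
Proof. exact: measurable_powR. Qed.

Lemma measurable_heat f g : measurable_fun setT f -> measurable_fun setT g ->
  measurable_fun setT (fun w => heat (f w) (g w)).
Proof.
move=> mf mg; apply: (measurableT_comp measurable_Phi).
by apply: measurable_funM => //; exact: measurableT_comp measurable_isqrt mg.
Qed.

Lemma measurable_dheat f g : measurable_fun setT f -> measurable_fun setT g ->
  measurable_fun setT (fun w => dheat (f w) (g w)).
Proof.
move=> mf mg.
have mq : measurable_fun setT (fun w => isqrt (g w)).
  exact: measurableT_comp measurable_isqrt mg.
apply: measurable_funM => //; apply: measurable_funM; first exact: measurable_funX.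
apply: (measurableT_comp (measurable_is_derive (@is_derive_phi2 R))).
exact: measurable_funM.
Qed.

Lemma integrable_cstR (P : probability T R) (k : R) :
  P.-integrable setT (EFin \o (fun=> k)).
Proof. exact: finite_measure_integrable_cst. Qed.

Lemma Rintegral_cst_probability (P : probability T R) (k : R) : \int[P]_w k = k.
Proof.
rewrite Rintegral_cst// [X in fine X](_ : _ = 1%E) ?mulr1//.
exact: (@probability_setT _ _ _ P).
Qed.

Lemma integrableBR (P : probability T R) f g :
  P.-integrable setT (EFin \o f) -> P.-integrable setT (EFin \o g) ->
  P.-integrable setT (EFin \o (fun w => f w - g w)).
Proof. exact: integrableB. Qed.

Lemma integrableDR (P : probability T R) f g :
  P.-integrable setT (EFin \o f) -> P.-integrable setT (EFin \o g) ->
  P.-integrable setT (EFin \o (fun w => f w + g w)).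
Proof. exact: integrableD. Qed.

Lemma integrableZlR (P : probability T R) (k : R) f :
  P.-integrable setT (EFin \o f) -> P.-integrable setT (EFin \o (fun w => k * f w)).
Proof. exact: integrableZl. Qed.

Lemma integrable_bounded (P : probability T R) f (M : R) :
  measurable_fun setT f -> (forall w, `|f w| <= M) ->
  P.-integrable setT (EFin \o f).
Proof.
move=> mf fM; apply: (@le_integrable _ _ _ _ _ _ _ (EFin \o cst M)) => //.
- exact/measurable_EFinP.
- by move=> w _; rewrite /= lee_fin (le_trans (fM _))// ler_norm.
- exact: finite_measure_integrable_cst.
Qed.

Lemma Rintegral_sumR (P : probability T R) (h : nat -> T -> R) (n : nat) :
  (forall k, P.-integrable setT (EFin \o h k)) ->
  P.-integrable setT (EFin \o (fun w => \sum_(0 <= k < n) h k w)) /\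
  \int[P]_w (\sum_(0 <= k < n) h k w) = \sum_(0 <= k < n) \int[P]_w h k w.
Proof.
move=> ih; elim: n => [|n [IHi IHe]].
  under [in EFin \o _]eq_fun do rewrite (big_geq (leqnn 0)).
  under eq_Rintegral do rewrite (big_geq (leqnn 0)).
  rewrite (big_geq (leqnn 0)) Rintegral_cst_probability; split => //.
  exact: integrable_cstR.
under [in EFin \o _]eq_fun do rewrite (big_nat_recr _ _ _ (leq0n n)).
under eq_Rintegral do rewrite (big_nat_recr _ _ _ (leq0n n)).
rewrite (big_nat_recr _ _ _ (leq0n n)) /= (RintegralD measurableT IHi (ih n)) IHe.
by split => //; exact: integrableDR IHi (ih n).
Qed.

Lemma le_integrableR (P : probability T R) f g :
  measurable_fun setT f -> (forall w, `|f w| <= `|g w|) ->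
  P.-integrable setT (EFin \o g) -> P.-integrable setT (EFin \o f).
Proof.
move=> mf fg; apply: le_integrable => //; first exact/measurable_EFinP.
by move=> w _; rewrite /= lee_fin.
Qed.

End Measurability.

Lemma heat01 (R : realType) (y v : R) : `|heat y v| <= 1.
Proof. by have /andP[? ?] := Phi01 (y * isqrt v); rewrite ger0_norm. Qed.

Section LindebergStep.
Context d d' (T : measurableType d) (T' : measurableType d') (R : realType).
Variables (P : probability T R) (X : {mfun T >-> T'}) (Y : {RV P >-> R}).
Hypothesis indep : forall A B, measurable A -> measurable B ->
  P (X @^-1` A `&` Y @^-1` B) = (P (X @^-1` A) * P (Y @^-1` B))%E.
Hypothesis iY : P.-integrable setT (EFin \o Y).
Hypothesis iY2 : P.-integrable setT (EFin \o (fun w => Y w ^+ 2)).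
Hypothesis EY : \int[P]_w Y w = 0.
Hypothesis EY2 : \int[P]_w (Y w ^+ 2) = 1.

(** The two low-order terms of [heat_step] are functions of [X] times [Y] or [Y ^+ 2 - 1], so
    independence makes their expectations vanish. What is left is the integrated remainder, which
    independence factors again. *)
Lemma lindeberg_step (a v y : T' -> R) (c e : R) :
  measurable_fun setT a -> measurable_fun setT v -> measurable_fun setT y ->
  0 < c -> c <= 1 -> (forall x, c <= v x) -> (forall x, `|a x| <= e) ->
  `| \int[P]_w heat (y (X w) - a (X w) * Y w) (v (X w))
     - \int[P]_w heat (y (X w)) (v (X w) + a (X w) ^+ 2) |
  <= 4 * c^-1 ^+ 2 * (\int[P]_w (a (X w) ^+ 2) *
       (\int[P]_w (Y w ^+ 2 * Num.min (e * `|Y w|) 1) + e ^+ 2)).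
Proof.
move=> ma mv my c0 c1 cv ae.
have mX (f : T' -> R) : measurable_fun setT f -> measurable_fun setT (fun w => f (X w)).
  by move=> mf; exact: measurableT_comp mf _.
have v0 x : 0 < v x := lt_le_trans c0 (cv x).
have a2e x : a x ^+ 2 <= e ^+ 2.
  by rewrite -(real_normK (num_real (a x))) lerXn2r ?nnegrE// (le_trans _ (ae x)).
have e0 : 0 <= e by apply: le_trans (ae point).
(* [H1] and [H2] are the coefficients of the first- and second-order terms; they are bounded because
   [a] is and [v] stays above [c]. *)
pose H1 x := - (a x * isqrt (v x) * phi (y x * isqrt (v x))).
pose H2 x := a x ^+ 2 * dheat (y x) (v x).
pose u w := heat (y (X w) - a (X w) * Y w) (v (X w)).
pose u' w := heat (y (X w)) (v (X w) + a (X w) ^+ 2).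
pose g t := t ^+ 2 * Num.min (e * `|t|) 1 + e ^+ 2 : R.
have mH1 : measurable_fun setT H1.
  apply: measurableT_comp => //.
  have mq : measurable_fun setT (fun x => isqrt (v x)).
    exact: measurableT_comp (@measurable_isqrt R) mv.
  apply: measurable_funM; first exact: measurable_funM.
  by apply: measurableT_comp (@measurable_phi R) _; exact: measurable_funM.
have mH2 : measurable_fun setT H2.
  by apply: measurable_funM; [exact: measurable_funX|exact: measurable_dheat].
have H1M x : `|H1 x| <= e * c^-1.
  rewrite /H1 normrN !normrM -[leRHS]mulr1; apply: ler_pM => //; last exact: phi_le1.
  by apply: ler_pM => //; rewrite gtr0_norm ?isqrt_gt0// isqrt_le.
have H2M x : `|H2 x| <= e ^+ 2 * c^-1.
  by rewrite /H2 normrM ger0_norm ?sqr_ge0//; apply: ler_pM; rewrite ?sqr_ge0//; exact: dheat_le.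
have mu : measurable_fun setT u.
  apply: measurable_heat; last exact: mX.
  by apply: measurable_funB; [exact: mX|apply: measurable_funM => //; exact: mX].
have mu' : measurable_fun setT u'.
  apply: measurable_heat; first exact: mX.
  by apply: measurable_funD; [exact: mX|apply: measurable_funX; exact: mX].
have iu : P.-integrable setT (EFin \o u).
  by apply: integrable_bounded => // w; exact: heat01.
have iu' : P.-integrable setT (EFin \o u').
  by apply: integrable_bounded => // w; exact: heat01.
have mg : measurable_fun setT g.
  apply: measurable_funD => //; apply: measurable_funM; first exact: measurable_funX.
  apply: measurable_minr => //; apply: measurable_funM => //.
have iY21 : P.-integrable setT (EFin \o (fun w => Y w ^+ 2 - 1)).
  exact: integrableBR iY2 (integrable_cstR P 1).
have imin : P.-integrable setT (EFin \o (fun w => Y w ^+ 2 * Num.min (e * `|Y w|) 1)).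
  apply: le_integrableR iY2.
    apply: measurable_funM; first exact: measurable_funX.
    apply: measurable_minr => //; apply: measurable_funM => //.
    exact: measurableT_comp.
  move=> w; rewrite normrM ler_piMr// ger0_norm; last by rewrite le_min mulr_ge0 ?ler01.
  by rewrite ge_min lexx orbT.
have ig : P.-integrable setT (EFin \o (g \o Y)).
  exact: integrableDR imin (integrable_cstR P (e ^+ 2)).
have iH1 : P.-integrable setT (EFin \o (fun w => H1 (X w) * Y w)).
  apply: (@le_integrableR _ _ _ _ _ (fun w => e * c^-1 * Y w)).
  - by apply: measurable_funM; first exact: mX.
  - by move=> w; rewrite !normrM ler_wpM2r// -normrM (le_trans (H1M _))// ler_norm.
  - exact: (integrableZlR (e * c^-1) iY).
have iH2 : P.-integrable setT (EFin \o (fun w => H2 (X w) * (Y w ^+ 2 - 1))).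
  apply: (@le_integrableR _ _ _ _ _ (fun w => e ^+ 2 * c^-1 * (Y w ^+ 2 - 1))).
  - apply: measurable_funM; first exact: mX.
    by apply: measurable_funB => //; exact: measurable_funX.
  - move=> w; rewrite normrM [leRHS]normrM ler_wpM2r// (le_trans (H2M _))//.
    exact: ler_norm.
  - exact: (integrableZlR (e ^+ 2 * c^-1) iY21).
have iag : P.-integrable setT (EFin \o (fun w => a (X w) ^+ 2 * g (Y w))).
  apply: (@le_integrableR _ _ _ _ _ (fun w => e ^+ 2 * g (Y w))).
  - apply: measurable_funM; first by apply: measurable_funX; exact: mX.
    exact: measurableT_comp mg _.
  - move=> w; rewrite normrM [leRHS]normrM ler_wpM2r//.
    by rewrite (ger0_norm (sqr_ge0 (a _))) (ger0_norm (sqr_ge0 e)).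
  - exact: (integrableZlR (e ^+ 2) ig).
(* Subtracting the centered terms leaves the expectation unchanged and makes the integrand small
   pointwise. *)
pose D w := u w - u' w - H1 (X w) * Y w - H2 (X w) * (Y w ^+ 2 - 1).
have iD1 := integrableBR iu iu'.
have iD2 := integrableBR iD1 iH1.
have iD := integrableBR iD2 iH2.
have E1 : \int[P]_w (H1 (X w) * Y w) = 0.
  by rewrite (@Rintegral_indepM _ _ _ _ _ _ _ _ H1 id _ indep mH1 H1M)// EY mulr0.
have E2 : \int[P]_w (H2 (X w) * (Y w ^+ 2 - 1)) = 0.
  rewrite (@Rintegral_indepM _ _ _ _ _ _ _ _ H2 (fun t => t ^+ 2 - 1) _ indep mH2 H2M)//.
    rewrite RintegralB//; last exact: (integrable_cstR P 1).
    by rewrite EY2 Rintegral_cst_probability subrr mulr0.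
  by apply: measurable_funB => //; exact: measurable_funX.
have -> : \int[P]_w u w - \int[P]_w u' w = \int[P]_w D w.
  rewrite (RintegralB measurableT iD2 iH2) E2 subr0.
  rewrite (RintegralB measurableT iD1 iH1) E1 subr0.
  by rewrite (RintegralB measurableT iu iu').
have -> : 4 * c^-1 ^+ 2 * (\int[P]_w (a (X w) ^+ 2) *
       (\int[P]_w (Y w ^+ 2 * Num.min (e * `|Y w|) 1) + e ^+ 2)) =
    \int[P]_w (4 * c^-1 ^+ 2 * (a (X w) ^+ 2 * g (Y w))).
  rewrite RintegralZl//; congr (_ * _).
  rewrite (@Rintegral_indepM _ _ _ _ _ _ _ _ (fun x => a x ^+ 2) g (e ^+ 2) indep)//.
  - rewrite RintegralD//; last exact: (integrable_cstR P (e ^+ 2)).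
    by rewrite Rintegral_cst_probability.
  - exact: measurable_funX.
  - by move=> x; rewrite ger0_norm ?sqr_ge0.
apply: (le_trans (le_normr_Rintegral measurableT iD)).
apply: le_Rintegral => //.
- exact: integrable_norm.
- exact: (integrableZlR (4 * c^-1 ^+ 2) iag).
- by move=> w _; apply: heat_step.
Qed.

End LindebergStep.

(** * Telescoping the replacements over a row *)

Section LindebergTelescope.
Context d (T : measurableType d) (R : realType).
Variables (P : probability T R) (G : nat -> set (set T)).
Variables (n : nat) (a : nat -> T -> R) (xi : nat -> {RV P >-> R}).
Hypothesis GT : forall k, G k `<=` measurable.
Hypothesis ma : forall j k,
  measurable_fun setT (a j : g_sigma_algebraType (G k) -> R).
Hypothesis mxi : forall j k, (j < k)%N ->
  measurable_fun setT (xi j : g_sigma_algebraType (G k) -> R).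
Hypothesis indep : forall k A B, <<s G k >> A -> measurable B ->
  P (A `&` xi k @^-1` B) = (P A * P (xi k @^-1` B))%E.
Hypothesis ixi : forall k, P.-integrable setT (EFin \o xi k).
Hypothesis ixi2 : forall k, P.-integrable setT (EFin \o (fun w => xi k w ^+ 2)).
Hypothesis Exi : forall k, \int[P]_w xi k w = 0.
Hypothesis Exi2 : forall k, \int[P]_w (xi k w ^+ 2) = 1.
Variables (c e s2 m : R).
Hypotheses (c0 : 0 < c) (c1 : c <= 1) (m0 : 0 <= m).
Hypothesis ae : forall j w, `|a j w| <= e.
Hypothesis as2 : forall w, \sum_(0 <= j < n) a j w ^+ 2 <= s2.
Hypothesis Em : forall k, \int[P]_w (xi k w ^+ 2 * Num.min (e * `|xi k w|) 1) = m.

(** Passing from [k] to [k.+1] trades the variance [a k ^+ 2] for the noise [a k * xi k]. The step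
    errors are proportional to the expectations of [a k ^+ 2], whose sum is at most [s2], so the
    total does not depend on [n]. *)
Lemma lindeberg_telescope (r : R) :
  `| \int[P]_w heat (r - \sum_(0 <= j < n) a j w * xi j w) c
     - \int[P]_w heat r (c + \sum_(0 <= j < n) a j w ^+ 2) |
  <= 4 * c^-1 ^+ 2 * (s2 * (m + e ^+ 2)).
Proof.
pose S k w := r - \sum_(0 <= j < k) a j w * xi j w.
pose V k w := c + \sum_(k <= j < n) a j w ^+ 2.
pose Y k := \int[P]_w heat (S k w) (V k w).
have mid k : measurable_fun setT (id : T -> g_sigma_algebraType (G k)).
  move=> _ A mA; rewrite setTI preimage_id.
  by apply: smallest_sub mA => //; exact: sigma_algebra_measurable.
have maT j : measurable_fun setT (a j).
  by have := measurableT_comp (@ma j 0%N) (mid 0%N).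
have ia2 j : P.-integrable setT (EFin \o (fun w => a j w ^+ 2)).
  apply: (@integrable_bounded _ _ _ _ _ (e ^+ 2)); first exact: measurable_funX.
  move=> w; rewrite normrX lerXn2r ?nnegrE//.
  exact: le_trans (ae j w).
have step k : (k < n)%N ->
    `|Y k.+1 - Y k| <= 4 * c^-1 ^+ 2 * (\int[P]_w (a k w ^+ 2) * (m + e ^+ 2)).
  move=> kn.
  (* The identity, with the smaller sigma-algebra on the target: a measurable function of [X] is one
     determined by the past. *)
  pose X : {mfun T >-> g_sigma_algebraType (G k)} :=
    HB.pack (id : T -> g_sigma_algebraType (G k))
      (isMeasurableFun.Build _ _ _ _ _ (mid k)).
  (* [V k.+1] involves later weights; this is admissible since [ma] places all weights of the row in
     every past. *)
  have mV : measurable_fun setT (V k.+1 : g_sigma_algebraType (G k) -> R).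
    apply: measurable_funD => //.
    apply: (@measurable_sum _ (g_sigma_algebraType (G k))) => j.
    exact: measurable_funX.
  have mS : measurable_fun setT (S k : g_sigma_algebraType (G k) -> R).
    rewrite /S.
    under eq_fun do rewrite big_mkord.
    apply: measurable_funB => //.
    apply: (@measurable_sum _ (g_sigma_algebraType (G k))) => j.
    by apply: measurable_funM => //; exact: mxi.
  have := @lindeberg_step _ _ T (g_sigma_algebraType (G k)) R P X (xi k) (@indep k)
    (ixi k) (ixi2 k) (Exi k) (Exi2 k) _ _ _ c e (@ma k k) mV mS c0 c1 _ (ae k).
  rewrite Em => H.
  have -> : Y k.+1 = \int[P]_w heat (S k w - a k w * xi k w) (V k.+1 w).
    by apply: eq_Rintegral => w _; rewrite /S big_nat_recr//= opprD addrA.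
  have -> : Y k = \int[P]_w heat (S k w) (V k.+1 w + a k w ^+ 2).
    apply: eq_Rintegral => w _; congr heat.
    by rewrite /V (big_ltn kn) [X in c + X]addrC addrA.
  by apply: H => w; rewrite /V lerDl sumr_ge0// => j _; exact: sqr_ge0.
have S0 w : S 0%N w = r by rewrite /S (big_geq (leqnn 0)) subr0.
have Vn w : V n w = c by rewrite /V (big_geq (leqnn n)) addr0.
have EYn : Y n = \int[P]_w heat (r - \sum_(0 <= j < n) a j w * xi j w) c.
  by apply: eq_Rintegral => w _; rewrite Vn.
have EY0 : Y 0%N = \int[P]_w heat r (c + \sum_(0 <= j < n) a j w ^+ 2).
  by apply: eq_Rintegral => w _; rewrite S0.
suff : `|Y n - Y 0%N| <= 4 * c^-1 ^+ 2 * (s2 * (m + e ^+ 2)) by rewrite EYn EY0.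
rewrite -(telescope_sumr Y (leq0n n)).
apply: (le_trans (ler_norm_sum _ _ _)).
apply: (@le_trans _ _ (\sum_(0 <= k < n)
    4 * c^-1 ^+ 2 * (\int[P]_w (a k w ^+ 2) * (m + e ^+ 2)))).
  by rewrite !big_mkord; apply: ler_sum => k _; exact: step.
rewrite -mulr_sumr -mulr_suml; apply: ler_wpM2l; first by rewrite mulr_ge0 ?sqr_ge0.
apply: ler_wpM2r; first by rewrite addr_ge0 ?sqr_ge0.
have -> : \sum_(0 <= k < n) \int[P]_w (a k w ^+ 2) =
    \int[P]_w \sum_(0 <= k < n) a k w ^+ 2.
  by have [_ ->] := Rintegral_sumR n ia2.
apply: (@le_trans _ _ (\int[P]_w s2)); last by rewrite Rintegral_cst_probability.
have [isum _] := Rintegral_sumR n ia2.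
by apply: (le_Rintegral measurableT isum (integrable_cstR P s2)) => w _; exact: as2.
Qed.

End LindebergTelescope.

(** * Independence of the past *)

Section Past.
Context d (T : measurableType d) (R : realType) (P : probability T R).
Context (I : Type) (V : I -> {RV P >-> R}) (xi : nat -> {RV P >-> R}).

(* A pi-system generating the sigma-algebra of [V] and of the [xi j], [j < k]. *)
Definition past_sets (k : nat) : set (set T) :=
  [set E | exists A B, [/\ sigma_family V A, (forall j, measurable (B j)) &
    E = A `&` \bigcap_(j in [set j | (j < k)%N]) xi j @^-1` B j]].

Lemma sigma_family_measurable (J : Type) (X : J -> {RV P >-> R}) :
  sigma_family X `<=` measurable.
Proof.
apply: smallest_sub; first exact: sigma_algebra_measurable.
by move=> _ [j _] [B mB <-]; exact: measurable_funPT.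
Qed.

Lemma sigma_family_preimage (J : Type) (X : J -> {RV P >-> R}) j B :
  measurable B -> sigma_family X (X j @^-1` B).
Proof.
by move=> mB; apply: sub_sigma_algebra; exists j => //; exists B; rewrite ?setTI.
Qed.

Lemma sigma_familyI (J : Type) (X : J -> {RV P >-> R}) A B :
  sigma_family X A -> sigma_family X B -> sigma_family X (A `&` B).
Proof. exact: (@measurableI _ (g_sigma_algebraType _)). Qed.

Lemma sigma_familyT (J : Type) (X : J -> {RV P >-> R}) : sigma_family X setT.
Proof. exact: (@measurableT _ (g_sigma_algebraType _)). Qed.

Lemma sigma_family_past k (B : nat -> set R) : (forall j, measurable (B j)) ->
  sigma_family xi (\bigcap_(j in [set j | (j < k)%N]) xi j @^-1` B j).
Proof.
move=> mB; apply: (@fin_bigcap_measurable _ (g_sigma_algebraType _)).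
  exact: finite_II.
by move=> j _; exact: (sigma_family_preimage _ (mB j)).
Qed.

Lemma past_sets_measurable k : past_sets k `<=` measurable.
Proof.
move=> _ [A [B [mA mB ->]]]; apply: measurableI; first exact: sigma_family_measurable mA.
exact: sigma_family_measurable (sigma_family_past k mB).
Qed.

Lemma past_setsI k : setI_closed (past_sets k).
Proof.
move=> _ _ [A [B [mA mB ->]]] [A' [B' [mA' mB' ->]]].
exists (A `&` A'), (fun j => B j `&` B' j); split.
- exact: sigma_familyI.
- by move=> j; exact: measurableI.
by rewrite setIACA bigcapI.
Qed.

Lemma sigma_family_sub_past k : sigma_family V `<=` past_sets k.
Proof.
move=> A mA; exists A, (fun=> setT); split => //.
by apply/seteqP; split => w // [].
Qed.

Lemma preimage_past j k B : (j < k)%N -> measurable B ->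
  past_sets k (xi j @^-1` B).
Proof.
move=> jk mB; exists setT, (fun i => if i == j then B else setT); split.
- exact: sigma_familyT.
- by move=> i; case: ifP.
rewrite setTI; apply/seteqP; split => [w wB i _|w /(_ j jk)]; last by rewrite eqxx.
by rewrite /preimage/=; case: eqP => // ->.
Qed.

Lemma measurable_past_family i k :
  measurable_fun setT (V i : g_sigma_algebraType (past_sets k) -> R).
Proof.
move=> _ B mB; rewrite setTI; apply: sub_sigma_algebra.
exact: sigma_family_sub_past (sigma_family_preimage _ mB).
Qed.

Lemma measurable_past_seq j k : (j < k)%N ->
  measurable_fun setT (xi j : g_sigma_algebraType (past_sets k) -> R).
Proof.
move=> jk _ B mB; rewrite setTI; apply: sub_sigma_algebra.
exact: preimage_past.
Qed.

(** The product formula is applied to the indices below [k] and to the same indices with [k] added;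
    the two products differ by exactly the factor of [xi k]. *)
Lemma mutually_independent_past k (B : nat -> set R) C :
  mutually_independent xi -> (forall j, measurable (B j)) -> measurable C ->
  P (\bigcap_(j in [set j | (j < k)%N]) xi j @^-1` B j `&` xi k @^-1` C) =
  (P (\bigcap_(j in [set j | (j < k)%N]) xi j @^-1` B j) * P (xi k @^-1` C))%E.
Proof.
move=> xiP mB mC.
pose J : {fset nat} := [fset i in iota 0 k]%fset.
pose B' j := if j == k then C else B j.
have mB' j : measurable (B' j) by rewrite /B'; case: ifP.
have kJ : k \notin J by rewrite !inE mem_iota add0n ltnn andbF.
have JE : [set` J] = [set j | (j < k)%N].
  by apply/seteqP; split => j /=; rewrite !inE mem_iota add0n.
have BB' j : (j < k)%N -> B' j = B j by move=> jk; rewrite /B' ltn_eqF.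
have -> : \bigcap_(j in [set j | (j < k)%N]) xi j @^-1` B j `&` xi k @^-1` C =
    \bigcap_(j in [set` (k |` J)%fset]) xi j @^-1` B' j.
  rewrite set_fsetU1 bigcap_setU1 setIC JE {1}/B' eqxx; congr (_ `&` _).
  by apply: eq_bigcapr => j jk; rewrite BB'.
rewrite xiP// big_fsetU1//= {1}/B' eqxx muleC; congr (_ * _)%E.
rewrite -JE (xiP J)//; apply: eq_big_seq => j.
by rewrite !inE mem_iota add0n => jk; rewrite BB'.
Qed.

(** For fixed [B], both sides are finite measures in [A]. They agree on the pi-system [past_sets k],
    hence on the sigma-algebra it generates. *)
Lemma past_indep k A B :
  mutually_independent xi -> independent_families V xi ->
  <<s past_sets k >> A -> measurable B ->
  P (A `&` xi k @^-1` B) = (P A * P (xi k @^-1` B))%E.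
Proof.
move=> xiP Vxi sA mB.
have mK : d.-measurable (xi k @^-1` B).
  exact: measurable_funPTI.
have Kfin : P (xi k @^-1` B) \is a fin_num by exact: fin_num_measure.
have K0 : 0 <= fine (P (xi k @^-1` B)) by exact: fine_ge0.
pose m1 := mrestr P mK.
pose m2 := mscale (NngNum K0) P.
suff : m1 A = m2 A by rewrite /m1 /m2 /mrestr /mscale/= fineK// muleC.
apply: (@g_sigma_algebra_measure_unique _ _ _ (past_sets k) _ (fun=> setT)) sA.
- exact: past_sets_measurable.
- by move=> _; apply: sigma_family_sub_past; exact: sigma_familyT.
- by rewrite bigcup_const.
- exact: past_setsI.
- move=> _ [A' [C [mA mC ->]]].
  set D := \bigcap_(j in _) _.
  change (P ((A' `&` D) `&` xi k @^-1` B) =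
    ((fine (P (xi k @^-1` B)))%:E * P (A' `&` D))%E).
  (* [Vxi] splits off [P A'] on both sides, and mutual independence separates [D] from [xi k] in
     between. *)
  rewrite fineK// -setIA.
  rewrite Vxi//; last first.
    by apply: sigma_familyI; [exact: sigma_family_past|exact: sigma_family_preimage].
  rewrite mutually_independent_past// Vxi//; last exact: sigma_family_past.
  by rewrite muleA muleC.
- by move=> _; exact: (fin_num_fun_lty (fin_num_measure (mrestr P mK))).
Qed.

End Past.

(** * Moments *)

Section Moments.
Context d (T : measurableType d) (R : realType) (P : probability T R).
Implicit Types X Y : {RV P >-> R}.

(** Both integrals are the integral of [f] against the common law; integrability for [Y] follows
    from the same change of variables applied to the absolute value of [f]. *)
Lemma eq_distribution_Rintegral X Y (f : R -> R) :
  (forall B, measurable B -> distribution P X B = distribution P Y B) ->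
  measurable_fun setT f -> P.-integrable setT (EFin \o (fun w => f (X w))) ->
  P.-integrable setT (EFin \o (fun w => f (Y w))) /\
  \int[P]_w f (Y w) = \int[P]_w f (X w).
Proof.
move=> XY mf ifX.
have eXY g : (\int[distribution P X]_x g x = \int[distribution P Y]_x g x)%E.
  by apply: eq_measure_integral => A mA _; exact: XY.
have mEf : measurable_fun setT (EFin \o f) by exact/measurable_EFinP.
have ifY : P.-integrable setT (EFin \o (fun w => f (Y w))).
  apply/integrableP; split; first by apply/measurable_EFinP; exact: measurableT_comp.
  pose g x := `|(f x)%:E|%E.
  have mg : measurable_fun setT g by exact: measurableT_comp.
  have g0 x : (0 <= g x)%E by exact: abse_ge0.
  have <- : (\int[distribution P Y]_x g x = \int[P]_w `|(f (Y w))%:E|)%E.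
    exact: ge0_integral_distribution.
  rewrite -eXY (ge0_integral_distribution X mg g0).
  by case/integrableP : ifX.
split => //; congr fine.
have := integral_distribution mEf ifY; have := integral_distribution mEf ifX.
by move=> /= <- <-; rewrite eXY.
Qed.

(** Centering turns the variance into the second moment, and integrability of [X] then follows from
    the bound of [|x|] by [x ^+ 2 + 1]. *)
Lemma standardized_moments X : ('E_P[X] = 0)%E -> ('V_P[X] = 1)%E ->
  [/\ P.-integrable setT (EFin \o X),
    P.-integrable setT (EFin \o (fun w => X w ^+ 2)),
    \int[P]_w X w = 0 & \int[P]_w (X w ^+ 2) = 1].
Proof.
move=> EX; rewrite /variance unlock EX/= unlock => VX.
have EX2 : (\int[P]_w (X w ^+ 2)%:E = 1)%E.
  rewrite -[RHS]VX; apply: eq_integral => w _; congr (_%:E).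
  by change (X w ^+ 2 = (X w - 0) * (X w - 0)); rewrite subr0 expr2.
have iX2 : P.-integrable setT (EFin \o (fun w => X w ^+ 2)).
  apply/integrableP; split.
    by apply/measurable_EFinP; exact: measurable_funX.
  under eq_integral => w _ do rewrite /= ger0_norm ?sqr_ge0//.
  by rewrite EX2 ltry.
have iX : P.-integrable setT (EFin \o X).
  apply: (@le_integrableR _ _ _ _ _ (fun w => X w ^+ 2 + 1)) => //.
    move=> w; rewrite [leRHS]ger0_norm ?addr_ge0 ?sqr_ge0//.
    by rewrite -(real_normK (num_real (X w))); have := sqr_ge0 (`|X w| - 1); nra.
  exact: integrableDR iX2 (integrable_cstR P 1).
split => //; last by rewrite /Rintegral EX2.
by rewrite /Rintegral; move: EX; rewrite unlock => ->.
Qed.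

Lemma measurable_trunc_sqr (e : R) :
  measurable_fun setT (fun x : R => x ^+ 2 * Num.min (e * `|x|) 1).
Proof.
apply: measurable_funM; first exact: measurable_funX.
by apply: measurable_minr => //; apply: measurable_funM.
Qed.

Lemma integrable_trunc_sqr X (e : R) : 0 <= e ->
  P.-integrable setT (EFin \o (fun w => X w ^+ 2)) ->
  P.-integrable setT (EFin \o (fun w => X w ^+ 2 * Num.min (e * `|X w|) 1)).
Proof.
move=> e0; apply: le_integrableR.
  exact: (measurableT_comp (measurable_trunc_sqr e)).
move=> w; rewrite normrM ler_piMr// ger0_norm; last by rewrite le_min mulr_ge0 ?ler01.
by rewrite ge_min lexx orbT.
Qed.

(** Dominated convergence along [e = 1 / (n + 1)] with dominating function [X ^+ 2]. This plays the
    part of the Lindeberg condition and uses no moment beyond the second. *)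
Lemma trunc_sqr_small X (eta : R) : 0 < eta ->
  P.-integrable setT (EFin \o (fun w => X w ^+ 2)) ->
  exists e : R, [/\ 0 < e, e <= eta &
    \int[P]_w (X w ^+ 2 * Num.min (e * `|X w|) 1) <= eta].
Proof.
move=> eta0 iX2.
pose f n w := X w ^+ 2 * Num.min (harmonic n * `|X w|) 1.
have f0 n w : 0 <= f n w.
  by rewrite mulr_ge0 ?sqr_ge0// le_min mulr_ge0 ?ler01 ?invr_ge0.
have cvgf w : (f ^~ w) @ \oo --> (0 : R).
  apply: (@squeeze_cvgr _ _ _ _ (fun=> 0) (fun n => X w ^+ 2 * `|X w| * harmonic n)).
  - apply: nearW => n; rewrite f0/= /f -mulrA ler_wpM2l ?sqr_ge0//.
    by rewrite ge_min mulrC lexx.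
  - exact: cvg_cst.
  - by rewrite -[X in _ --> X](mulr0 (X w ^+ 2 * `|X w|)); apply: cvgMr => //; exact: cvg_harmonic.
have mf n : measurable_fun setT (f n).
  exact: (measurableT_comp (measurable_trunc_sqr _)).
have [|||[_ _]] := @dominated_convergence _ T R P setT measurableT
  (fun n w => (f n w)%:E) (cst 0%E) (EFin \o (fun w => X w ^+ 2))
  _ (measurable_cst _) _ iX2.
- by move=> n; exact/measurable_EFinP.
- by apply: aeW => w _; apply: cvg_EFin; [apply: nearW => n|exact: cvgf].
- apply: aeW => w n _; rewrite lee_fin ger0_norm//.
  by rewrite /f ler_piMr ?sqr_ge0// ge_min lexx orbT.
rewrite integral0 => /fine_cvgP[_ cvgI].
have cvgI_lt : \forall n \near \oo, \int[P]_w f n w < eta.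
  exact: (cvgr_lt _ cvgI).
have harm_lt : \forall n \near \oo, harmonic n < eta.
  exact: (cvgr_lt _ (@cvg_harmonic R)).
near \oo => n; exists (harmonic n); split.
- by rewrite /harmonic invr_gt0.
- by apply: ltW; near: n.
- by apply: ltW; near: n.
Unshelve. all: by end_near. Qed.

End Moments.

(** * Truncation of a row *)

Section Truncation.
Context (R : realType).
Implicit Types e : R.

Definition mean_sqr n (v : 'I_n -> R) : R := n%:R^-1 * \sum_(k < n) v k ^+ 2.

Definition max_weight n (v : 'I_n -> R) : R :=
  (\big[Num.max/0]_(k < n) `|v k|) / Num.sqrt n%:R.

Definition good_row e n (v : 'I_n -> R) : bool :=
  (`|mean_sqr v - 1| <= e) && (max_weight v <= e).

(** The normalized row, replaced by zero as a whole when it is bad, so that the bounds on weights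
    hold surely while the result still depends on the weights only. Indices are natural numbers for
    the telescoping; those outside the row get the value [0]. *)
Definition trunc_row e n (v : 'I_n -> R) (j : nat) : R :=
  if good_row e v then (if insub j is Some i then v i else 0) / Num.sqrt n%:R
  else 0.

Lemma trunc_row_le e n (v : 'I_n -> R) j : 0 <= e -> `|trunc_row e v j| <= e.
Proof.
move=> e0; rewrite /trunc_row; case: ifP => [/andP[_ ve]|_]; last by rewrite normr0.
apply: (le_trans _ ve); rewrite normrM normfV (ger0_norm (sqrtr_ge0 _)).
rewrite ler_wpM2r ?invr_ge0 ?sqrtr_ge0//.
case: insubP => [i _ _|_]; first exact: le_bigmax.
(* An index outside the row: the default [0] is below the maximum, which starts from [0]. *)
by rewrite normr0; elim/big_rec : _ => // i x _ x0; rewrite le_max normr_ge0.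
Qed.

Lemma sum_trunc_rowM e n (v : 'I_n -> R) (x : nat -> R) :
  \sum_(0 <= j < n) trunc_row e v j * x j =
  if good_row e v then (Num.sqrt n%:R)^-1 * \sum_(k < n) v k * x k else 0.
Proof.
rewrite big_mkord /trunc_row; case: ifP => _; last first.
  by rewrite big1// => k _; rewrite mul0r.
by rewrite mulr_sumr; apply: eq_bigr => k _; rewrite valK mulrAC mulrC.
Qed.

Lemma sum_trunc_row_sqr e n (v : 'I_n -> R) :
  \sum_(0 <= j < n) trunc_row e v j ^+ 2 =
  if good_row e v then mean_sqr v else 0.
Proof.
rewrite big_mkord /trunc_row; case: ifP => _; last first.
  by rewrite big1// => k _; rewrite expr0n.
rewrite /mean_sqr mulr_sumr; apply: eq_bigr => k _.
by rewrite valK expr_div_n sqr_sqrtr// mulrC.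
Qed.

Lemma sum_trunc_row_sqr_le e n (v : 'I_n -> R) : e <= 1 ->
  \sum_(0 <= j < n) trunc_row e v j ^+ 2 <= 2.
Proof.
move=> e1; rewrite sum_trunc_row_sqr; case: ifP => // /andP[+ _].
by rewrite ler_norml => /andP[_]; lra.
Qed.

Context d (T : measurableType d).

Lemma measurable_bigmaxr0 (I : Type) (s : seq I) (f : I -> T -> R) :
  (forall i, measurable_fun setT (f i)) ->
  measurable_fun setT (fun w => \big[Num.max/0]_(i <- s) f i w).
Proof.
move=> mf; elim: s => [|i s IH].
  by under eq_fun do rewrite big_nil; exact: measurable_cst.
under eq_fun do rewrite big_cons.
by apply: measurable_maxr => //; exact: measurableT_comp.
Qed.

Lemma measurable_mean_sqr n (v : 'I_n -> T -> R) :
  (forall i, measurable_fun setT (v i)) ->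
  measurable_fun setT (fun w => mean_sqr (v ^~ w)).
Proof.
move=> mv; apply: measurable_funM => //; apply: measurable_sum => k.
exact: measurable_funX.
Qed.

Lemma measurable_max_weight n (v : 'I_n -> T -> R) :
  (forall i, measurable_fun setT (v i)) ->
  measurable_fun setT (fun w => max_weight (v ^~ w)).
Proof.
move=> mv; apply: measurable_funM => //; apply: measurable_bigmaxr0 => k.
exact: measurableT_comp.
Qed.

Lemma measurable_good_row e n (v : 'I_n -> T -> R) :
  (forall i, measurable_fun setT (v i)) ->
  measurable_fun setT (fun w => good_row e (v ^~ w)).
Proof.
move=> mv; apply: measurable_and.
  apply: measurable_fun_ler => //; apply: measurableT_comp => //.
  by apply: measurable_funB => //; exact: measurable_mean_sqr.
by apply: measurable_fun_ler => //; exact: measurable_max_weight.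
Qed.

Lemma measurable_trunc_row e n (v : 'I_n -> T -> R) j :
  (forall i, measurable_fun setT (v i)) ->
  measurable_fun setT (fun w => trunc_row e (v ^~ w) j).
Proof.
move=> mv; apply: measurable_fun_ifT => //; first exact: measurable_good_row.
by apply: measurable_funM => //; case: insubP.
Qed.

End Truncation.

(** * Convergence of the smoothed distribution functions *)

(** To be used with [p] the probability of a bad row, [q] the error in the total variance and [b]
    the telescoping error. *)
Lemma ler_dist_chain (R : realFieldType) (x1 x2 x3 h p q b : R) :
  `|x1 - x2| <= p -> `|x3 - h| <= p + q -> `|x2 - x3| <= b ->
  `|x1 - h| <= 2 * p + q + b.
Proof.
rewrite !ler_norml => /andP[? ?] /andP[? ?] /andP[? ?].
by apply/andP; split; lra.
Qed.

Section HeatConvergence.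
Context d (T : measurableType d) (R : realType) (P : probability T R).
Variables (xi : nat -> {RV P >-> R}) (W : forall n : nat, 'I_n -> {RV P >-> R}).
Arguments W : clear implicits.
Hypothesis xi_indep : mutually_independent xi.
Hypothesis xi_id : identically_distributed xi.
Hypothesis xi_mean : ('E_P[xi 0%N] = 0)%E.
Hypothesis xi_var : ('V_P[xi 0%N] = 1)%E.
Hypothesis W_xi_indep : independent_families (array_family W) xi.

Lemma le_dist_Rintegral (f g h : T -> R) :
  P.-integrable setT (EFin \o f) -> P.-integrable setT (EFin \o g) ->
  P.-integrable setT (EFin \o h) -> (forall w, `|f w - g w| <= h w) ->
  `|\int[P]_w f w - \int[P]_w g w| <= \int[P]_w h w.
Proof.
move=> intf intg inth fgh; rewrite -(RintegralB measurableT intf intg).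
have ifg := integrableBR intf intg.
apply: (le_trans (le_normr_Rintegral measurableT ifg)).
by apply: le_Rintegral => //; exact: integrable_norm.
Qed.

Lemma le_dist_Rintegral_cst (f h : T -> R) (k : R) :
  P.-integrable setT (EFin \o f) -> P.-integrable setT (EFin \o h) ->
  (forall w, `|f w - k| <= h w) -> `|\int[P]_w f w - k| <= \int[P]_w h w.
Proof.
move=> intf inth fkh; rewrite -[k](Rintegral_cst_probability P).
exact: le_dist_Rintegral (integrable_cstR P k) inth fkh.
Qed.

Lemma RintegralD_cst (f : T -> R) (k : R) : P.-integrable setT (EFin \o f) ->
  \int[P]_w (f w + k) = \int[P]_w f w + k.
Proof.
move=> intf; rewrite (RintegralD measurableT intf (integrable_cstR P k)).
by rewrite Rintegral_cst_probability.
Qed.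

Lemma heat_dist1 (y v y' v' : R) : `|heat y v - heat y' v'| <= 1.
Proof.
rewrite /heat; have := Phi01 (y' * isqrt v'); have := Phi01 (y * isqrt v).
move: (Phi _) (Phi _) => p q /andP[? ?] /andP[? ?].
by rewrite ler_norml; apply/andP; split; lra.
Qed.

(** Three comparisons: truncating the row costs the probability of a bad row, since values of [heat]
    differ by at most [1]; the telescope applies to the truncated row with [s2 = 2]; and replacing
    its total variance by [1] costs [c^-1 * e] on good rows and again at most [1] on bad ones. *)
Lemma heat_weighted_sum_bound n (c e r : R) : 0 < c -> c <= 1 -> 0 <= e -> e <= 1 ->
  `| \int[P]_w heat (r - weighted_sum W xi n w) c - heat r (c + 1) | <=
  2 * fine (P [set w | ~~ good_row e (fun i => W n i w)]) + c^-1 * e +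
  4 * c^-1 ^+ 2 * (2 * (\int[P]_w (xi 0%N w ^+ 2 * Num.min (e * `|xi 0%N w|) 1)
                         + e ^+ 2)).
Proof.
move=> c0 c1 e0 e1.
have [ixi ixi2 Exi Exi2] := standardized_moments xi_mean xi_var.
have idR k := @eq_distribution_Rintegral _ _ _ P (xi 0%N) (xi k) _
  (fun B mB => xi_id 0%N k mB).
pose m := \int[P]_w (xi 0%N w ^+ 2 * Num.min (e * `|xi 0%N w|) 1).
pose a j w := trunc_row e (fun i => W n i w) j.
pose bad : set T := [set w | ~~ good_row e (fun i => W n i w)].
have mW i : measurable_fun setT (W n i) by [].
have mgood : measurable_fun setT (fun w => good_row e (fun i => W n i w)).
  exact: (measurable_good_row e mW).
have badE : bad = (fun w => good_row e (fun i => W n i w)) @^-1` [set false].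
  apply/seteqP; split => [w /negbTE //|w]; rewrite /bad/= => ->//.
have mbad : measurable bad.
  by rewrite badE -[X in measurable X]setTI; exact: mgood.
have ma j : measurable_fun setT (a j) by exact: measurable_trunc_row.
pose S w := \sum_(0 <= j < n) a j w * xi j w.
pose V w := \sum_(0 <= j < n) a j w ^+ 2.
have mS : measurable_fun setT S.
  rewrite /S; under eq_fun do rewrite big_mkord.
  by apply: measurable_sum => j; apply: measurable_funM.
have mV : measurable_fun setT V.
  rewrite /V; under eq_fun do rewrite big_mkord.
  by apply: measurable_sum => j; apply: measurable_funX.
have mXi : measurable_fun setT (weighted_sum W xi n).
  exact: (measurable_funPT (weighted_sum_RV W xi n)).
have iheat (y v : T -> R) : measurable_fun setT y -> measurable_fun setT v ->
    P.-integrable setT (EFin \o (fun w => heat (y w) (v w))).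
  move=> my mv; apply: (@integrable_bounded _ _ _ _ _ 1) => [|w].
    exact: measurable_heat.
  exact: heat01.
have i1 : P.-integrable setT (EFin \o (fun w => heat (r - weighted_sum W xi n w) c)).
  by apply: iheat => //; exact: measurable_funB.
have i2 : P.-integrable setT (EFin \o (fun w => heat (r - S w) c)).
  by apply: iheat => //; exact: measurable_funB.
have i3 : P.-integrable setT (EFin \o (fun w => heat r (c + V w))).
  by apply: iheat => //; exact: measurable_funD.
have i4 : P.-integrable setT (EFin \o (\1_bad : T -> R)).
  by apply: (@integrable_bounded _ _ _ _ _ 1) => // w; rewrite indicE ger0_norm; case: (_ \in _).
have Ebad : \int[P]_w \1_bad w = fine (P bad).
  by rewrite /Rintegral integral_indic// setIT.
have D1 w : `|heat (r - weighted_sum W xi n w) c - heat (r - S w) c| <= \1_bad w.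
  rewrite indicE; case: (boolP (w \in bad)) => [_|]; first exact: heat_dist1.
  rewrite notin_setE /bad/= => /negP; rewrite negbK => gw.
  by rewrite /S sum_trunc_rowM gw /weighted_sum subrr normr0.
have H1 := le_dist_Rintegral i1 i2 i4 D1.
have D2 w : `|heat r (c + V w) - heat r (c + 1)| <= \1_bad w + c^-1 * e.
  have ce0 : 0 <= c^-1 * e by rewrite mulr_ge0 ?invr_ge0 ?(ltW c0).
  rewrite indicE; case: (boolP (w \in bad)) => [_|].
    by apply: (le_trans (heat_dist1 _ _ _ _)); rewrite /= lerDl.
  rewrite notin_setE /bad/= => /negP; rewrite negbK => gw.
  rewrite add0r /V sum_trunc_row_sqr gw.
  have /andP[g1 _] := gw.
  have m0 : 0 <= mean_sqr (fun i => W n i w).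
    by rewrite mulr_ge0 ?invr_ge0// sumr_ge0// => k _; rewrite sqr_ge0.
  apply: (le_trans (@heat_lip _ r c (c + 1) _ c0 _ _)); rewrite ?lerDl//.
  apply: ler_wpM2l; first by rewrite invr_ge0 ltW.
  by rewrite opprD addrACA subrr add0r.
have H2 := le_dist_Rintegral_cst i3
  (integrableDR i4 (integrable_cstR P (c^-1 * e))) D2.
rewrite (RintegralD_cst _ i4) in H2.
rewrite Ebad in H1 H2.
have mid : measurable_fun setT (fun x : R => x) by exact: measurable_id.
have msq : measurable_fun setT (fun x : R => x ^+ 2) by exact: measurable_funX.
have H3 : `|\int[P]_w heat (r - S w) c - \int[P]_w heat r (c + V w)| <=
    4 * c^-1 ^+ 2 * (2 * (m + e ^+ 2)).
  apply: (@lindeberg_telescope _ _ _ P (past_sets (array_family W) xi) n a xi).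
  - exact: past_sets_measurable.
  - move=> j k; apply: (@measurable_trunc_row _ _ (g_sigma_algebraType _) _ _ (W n)) => i.
    exact: (@measurable_past_family _ _ _ _ _ (array_family W) xi (existT _ n i)).
  - by move=> j k jk; exact: measurable_past_seq.
  - by move=> k A B; exact: past_indep.
  - by move=> k; case: (idR (fun x => x) k mid ixi).
  - by move=> k; case: (idR (fun x => x ^+ 2) k msq ixi2).
  - by move=> k; rewrite -Exi; case: (idR (fun x => x) k mid ixi).
  - by move=> k; rewrite -Exi2; case: (idR (fun x => x ^+ 2) k msq ixi2).
  - exact: c0.
  - exact: c1.
  - apply: Rintegral_ge0 => w _; rewrite mulr_ge0 ?sqr_ge0// le_min ler01 andbT.
    by rewrite mulr_ge0.
  - by move=> j w; exact: trunc_row_le.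
  - by move=> w; exact: sum_trunc_row_sqr_le.
  - move=> k; case: (idR (fun x => x ^+ 2 * Num.min (e * `|x|) 1) k) => //.
      exact: measurable_trunc_sqr.
    exact: integrable_trunc_sqr.
exact: ler_dist_chain H1 H2 H3.
Qed.

End HeatConvergence.

(* [34 = 2 * (1 + 4 * 2 * 2)]. *)
Lemma error_budget (R : realFieldType) (eps c e m eta p1 p2 p : R) :
  0 < c -> c <= 1 -> 0 <= e -> e <= eta -> m <= eta -> eta <= 1 ->
  eta <= eps * c ^+ 2 / 34 -> p1 <= eps / 8 -> p2 <= eps / 8 -> p <= p1 + p2 ->
  2 * p + c^-1 * e + 4 * c^-1 ^+ 2 * (2 * (m + e ^+ 2)) <= eps.
Proof.
move=> c0 c1 e0 ee me e1 eeps hp1 hp2 hp.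
have ci : 1 <= c^-1 by rewrite invf_ge1.
have h : c^-1 ^+ 2 * eta <= eps / 34.
  have -> : eps / 34 = c^-1 ^+ 2 * (eps * c ^+ 2 / 34) by field; rewrite gt_eqF.
  by rewrite ler_wpM2l ?sqr_ge0.
have h1 : c^-1 * e <= c^-1 ^+ 2 * eta.
  rewrite expr2 -mulrA ler_wpM2l ?(le_trans _ ci)// (le_trans ee)//.
  by rewrite ler_peMl// (le_trans e0).
have h2 : c^-1 ^+ 2 * (m + e ^+ 2) <= c^-1 ^+ 2 * (2 * eta).
  by rewrite ler_wpM2l ?sqr_ge0//; nra.
move: h h1 h2; move: (c^-1) => k; nra.
Qed.

Lemma fin_sub_measureU d (T : measurableType d) (R : realType)
    (P : probability T R) (A B C : set T) :
  measurable A -> measurable B -> measurable C -> A `<=` B `|` C ->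
  fine (P A) <= fine (P B) + fine (P C).
Proof.
move=> mA mB mC ABC; rewrite -fineD ?fin_num_measure// fine_le ?fin_numD ?fin_num_measure//.
apply: (@le_trans _ _ (P (B `|` C))); last exact: measureU2.
by apply: le_measure => //; rewrite inE//; exact: measurableU.
Qed.

Lemma fine_cvg0_near (R : realType) (u : nat -> \bar R) (e : R) :
  u @ \oo --> 0%E -> 0 < e -> \forall n \near \oo, fine (u n) <= e.
Proof.
move=> /fine_cvgP[_ ucvg] e0.
have ue : \forall n \near \oo, fine (u n) < e by exact: (cvgr_lt _ ucvg).
by apply: filterS ue => n /ltW.
Qed.

Lemma cvg_heat_weighted_sum d (T : measurableType d) (R : realType)
    (P : probability T R) (xi : nat -> {RV P >-> R})
    (W : forall n : nat, 'I_n -> {RV P >-> R}) (c r : R) :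
  mutually_independent xi -> identically_distributed xi ->
  ('E_P[xi 0%N] = 0)%E -> ('V_P[xi 0%N] = 1)%E ->
  independent_families (array_family W) xi ->
  cvg_in_probability P (fun n w => mean_sqr (fun i => W n i w)) (cst 1) ->
  cvg_in_probability P (fun n w => max_weight (fun i => W n i w)) (cst 0) ->
  0 < c -> c <= 1 ->
  (fun n => \int[P]_w heat (r - weighted_sum W xi n w) c) @ \oo --> heat r (c + 1).
Proof.
move=> xi_indep xi_id xi_mean xi_var W_xi_indep A1 A2 c0 c1.
apply/cvgrPdist_le => eps eps0.
(* The cap [1] gives [e <= 1] and lets [e ^+ 2] be bounded by [eta]; the other entry absorbs the
   factor [c^-1 ^+ 2] of the error bound. *)
pose eta := Num.min 1 (eps * c ^+ 2 / 34).
have eta0 : 0 < eta by rewrite lt_min ltr01 divr_gt0 ?mulr_gt0 ?exprn_gt0.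
have [ixi ixi2 _ _] := standardized_moments xi_mean xi_var.
have [e [e0 eeta meta]] := trunc_sqr_small eta0 ixi2.
have eta1 : eta <= 1 by rewrite ge_min lexx.
have eta2 : eta <= eps * c ^+ 2 / 34 by rewrite ge_min lexx orbT.
have eps8 : 0 < eps / 8 by rewrite divr_gt0.
have N1 := fine_cvg0_near (A1 e e0) eps8.
have N2 := fine_cvg0_near (A2 e e0) eps8.
near=> n.
have mW i : measurable_fun setT (W n i) by [].
have mset (f : T -> R) (t : R) : measurable_fun setT f ->
    measurable [set w | e < `|f w - t|].
  move=> mf.
  have mh : measurable_fun setT (fun w => `|f w - t|).
    by apply: measurableT_comp => //; exact: measurable_funB.
  have := mh measurableT `]e, +oo[%classic (measurable_itv _); rewrite setTI.
  by congr measurable; apply/seteqP; split => w /=; rewrite in_itv/= andbT.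
have mbad : measurable [set w | ~~ good_row e (fun i => W n i w)].
  have mg : measurable_fun setT (fun w => good_row e (fun i => W n i w)).
    exact: (measurable_good_row e mW).
  have := mg measurableT [set false] Logic.I; rewrite setTI.
  congr measurable; apply/seteqP; split => w /=; last by move/negbTE.
  by move=> ->.
have m1 := mset _ 1 (measurable_mean_sqr mW).
have m2 := mset _ 0 (measurable_max_weight mW).
rewrite distrC.
apply: (le_trans (heat_weighted_sum_bound xi_indep xi_id xi_mean xi_var
  W_xi_indep n r c0 c1 (ltW e0) (le_trans eeta eta1))).
have b1 : fine (P [set w | e < `|mean_sqr (fun i => W n i w) - 1|]) <= eps / 8.
  by near: n; exact: N1.
have b2 : fine (P [set w | e < `|max_weight (fun i => W n i w) - 0|]) <= eps / 8.
  by near: n; exact: N2.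
apply: (error_budget c0 c1 (ltW e0) eeta meta eta1 eta2 b1 b2).
(* A bad row violates one of its two conditions, so it lies in one of the events whose probabilities
   (A1) and (A2) make small. *)
apply: fin_sub_measureU => // w /=.
rewrite negb_and -!ltNge => /orP[|me]; [by left|right].
by rewrite subr0 (lt_le_trans me)// ler_norm.
Unshelve. all: by end_near. Qed.

(** * From smoothed to actual distribution functions *)

Lemma Phi_nondecreasing (R : realType) (x y : R) : x <= y -> Phi x <= Phi y.
Proof.
move=> xy; rewrite -lee_fin -!normal_prob_rayE le_measure ?inE//.
exact: subitvPr.
Qed.

Lemma Phi_tails (R : realType) (e : R) : 0 < e ->
  exists A : R, [/\ 0 < A, 1 - e <= Phi A & Phi (- A) <= e].
Proof.
move=> e0.
have mid : measurable_fun setT (id : measurableTypeR R -> R) by exact: measurable_id.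
(* The identity under the normal law has cdf [Phi], so the general limits of a cdf at both
   infinities apply. *)
pose X : {RV (normal_prob (0 : R) 1) >-> R} := HB.pack (id : measurableTypeR R -> R)
  (isMeasurableFun.Build _ _ _ _ _ mid).
have cdfE : cdf X = EFin \o (@Phi R).
  by apply/funext => x; rewrite /= -normal_prob_rayE.
have cy : Phi x @[x --> +oo] --> (1 : R).
  by have := cvg_cdfy1 X; rewrite cdfE => /fine_cvgP[].
have cNy : Phi x @[x --> -oo] --> (0 : R).
  by have := cvg_cdfNy0 X; rewrite cdfE => /fine_cvgP[].
have h1 : \forall x \near +oo, 1 - e < Phi x.
  by apply: (cvgr_gt _ cy); rewrite ltrBlDr ltrDl.
have h2 : \forall x \near +oo, Phi (- x) < e.
  by apply: (cvgr_lt 0) => //; exact/(cvgNy_compNP (@Phi R)).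
near +oo_R => A; exists A; split.
- by near: A; exact: nbhs_pinfty_gt.
- by apply: ltW; near: A.
- by apply: ltW; near: A.
Unshelve. all: by end_near. Qed.

Lemma isqrt1 (R : realType) : isqrt (1 : R) = 1.
Proof. by rewrite /isqrt powR1. Qed.

Section Smoothing.
Context d (T : measurableType d) (R : realType) (P : probability T R).
Variable X : {RV P >-> R}.

Lemma indic_ray (r : R) w : \1_(X @^-1` `]-oo, r]) w = (X w <= r)%R%:R :> R.
Proof.
rewrite indicE; congr ((nat_of_bool _)%:R).
by apply/idP/idP; rewrite inE/= in_itv.
Qed.

(** Pointwise sandwich of the indicator of [X <= r]. Where [X <= r], the profile shifted right by
    [h] is at least [1 - e]; where [X > r], the one shifted left is at most [e]; the remaining cases
    only use that [Phi] lies between [0] and [1]. *)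
Lemma cdf_smoothing (r h c e : R) : 0 < c -> 0 <= e ->
  1 - e <= Phi (h * isqrt c) -> Phi (- (h * isqrt c)) <= e ->
  \int[P]_w heat (r - h - X w) c - e <= fine (cdf X r) /\
  fine (cdf X r) <= \int[P]_w heat (r + h - X w) c + e.
Proof.
move=> c0 e0 h1 h2; have q0 := ltW (isqrt_gt0 c0).
have mray : measurable (X @^-1` `]-oo, r]) by exact: measurable_funPTI.
have -> : fine (cdf X r) = \int[P]_w \1_(X @^-1` `]-oo, r]) w.
  by rewrite /Rintegral integral_indic// setIT.
have iheat t : P.-integrable setT (EFin \o (fun w => heat (t - X w) c)).
  apply: (@integrable_bounded _ _ _ _ _ 1) => [|w]; last exact: heat01.
  by apply: measurable_heat => //; exact: measurable_funB.
have i1 : P.-integrable setT (EFin \o (\1_(X @^-1` `]-oo, r]) : T -> R)).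
  apply: (@integrable_bounded _ _ _ _ _ 1) => // w.
  by rewrite indicE ger0_norm; case: (_ \in _).
split.
  rewrite lerBlDr -(RintegralD_cst _ i1).
  apply: (le_Rintegral measurableT (iheat _) (integrableDR i1 (integrable_cstR P e))) => w _.
  rewrite indic_ray; case: (leP (X w) r) => [_|rX].
    have /andP[_ Phi1] := Phi01 ((r - h - X w) * isqrt c).
    by apply: (le_trans Phi1); rewrite /= lerDl.
  rewrite add0r; apply: (le_trans _ h2); rewrite -mulNr; apply: Phi_nondecreasing.
  by rewrite ler_wpM2r//; lra.
rewrite -(RintegralD_cst _ (iheat _)).
apply: (le_Rintegral measurableT i1 (integrableDR (iheat _) (integrable_cstR P e))) => w _.
rewrite indic_ray; case: (leP (X w) r) => [Xr|_].
  rewrite -lerBlDr; apply: (le_trans h1); apply: Phi_nondecreasing.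
  by rewrite ler_wpM2r//; lra.
by have /andP[? _] := Phi01 ((r + h - X w) * isqrt c); rewrite addr_ge0.
Qed.

End Smoothing.

(** Both variances are at least [1], so [heat_lip] is used with floor [1] and its constant does not
    blow up as [c] shrinks; the shift by [h] costs at most [|h|]. *)
Lemma heat_near_Phi (R : realType) (r h c e : R) : 0 < c -> c <= e -> `|h| <= e ->
  `|heat (r + h) (c + 1) - Phi r| <= 2 * e.
Proof.
move=> c0 ce he.
have -> : Phi r = heat r 1 by rewrite /heat isqrt1 mulr1.
apply: (le_trans (ler_distD (heat (r + h) 1) _ _)).
rewrite mulr_natl mulr2n; apply: lerD.
  apply: (le_trans (@heat_lip _ (r + h) 1 1 (c + 1) ltr01 _ _)) => //.
    by rewrite lerDr ltW.
  by rewrite invr1 mul1r addrK gtr0_norm.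
apply: le_trans he; rewrite /heat isqrt1 !mulr1.
by apply: (le_trans (Phi_lip _ _)); rewrite addrAC subrr add0r.
Qed.

Lemma sandwich_budget (R : realFieldType) (F P0 l1 l2 i1 i2 e : R) :
  `|l1 - P0| <= 2 * e -> `|l2 - P0| <= 2 * e ->
  `|l1 - i1| <= e -> `|l2 - i2| <= e -> i1 - e <= F -> F <= i2 + e ->
  `|P0 - F| <= 4 * e.
Proof.
rewrite !ler_norml => /andP[? ?] /andP[? ?] /andP[? ?] /andP[? ?] ? ?.
by apply/andP; split; lra.
Qed.

Theorem theorem2p1 (d : measure_display) (T : measurableType d) (R : realType)
    (P : probability T R)
    (xi : nat -> {RV P >-> R})
    (W : forall n : nat, 'I_n -> {RV P >-> R})
    (xi_indep : mutually_independent xi)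
    (xi_id : identically_distributed xi)
    (xi_mean : ('E_P[xi 0%N] = 0)%E)
    (xi_var : ('V_P[xi 0%N] = 1)%E)
    (W_xi_indep : independent_families (array_family W) xi)
    (A1 : cvg_in_probability P
            (fun n w => n%:R^-1 * \sum_(k < n) W n k w ^+ 2) (cst 1))
    (A2 : cvg_in_probability P
            (fun n w => (\big[Num.max/0]_(k < n) `|W n k w|) / Num.sqrt n%:R)
            (cst 0)) :
  cvg_in_distribution (weighted_sum_RV W xi) (normal_prob 0 1).
Proof.
move=> r _; rewrite [X in _ --> X](_ : _ = (Phi r)%:E); last exact: normal_prob_rayE.
apply: cvg_EFin; first by apply: nearW => n; rewrite fin_num_measure.
apply/cvgrPdist_le => eps eps0.
(* The budget is [2 * e] for the distance of the smoothed limit to [Phi r], [e] for the convergence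
   in [n], and [e] for the smoothing of the indicator. *)
have [e e0 ->] : exists2 e, 0 < e & eps = 4 * e.
  by exists (eps / 4); [rewrite divr_gt0|field].
have [A [A0 hA hNA]] := Phi_tails e0.
(* The entry [e] bounds the effect of the extra variance; the entry [(e / A) ^+ 2] makes the shift
   [e] at least [A] standard deviations of the smoothing, so that the tails of [Phi] beyond it are
   below [e]. *)
pose c := Num.min (Num.min 1 e) ((e / A) ^+ 2).
have c0 : 0 < c by rewrite !lt_min ltr01 e0 exprn_gt0 ?divr_gt0.
have c1 : c <= 1 by rewrite !ge_min lexx.
have ce : c <= e by rewrite !ge_min lexx orbT.
have cA : A <= e * isqrt c.
  have q0 := isqrt_gt0 c0.
  rewrite -(@ler_pXn2r _ 2) ?nnegrE ?mulr_ge0 ?(ltW e0) ?(ltW A0) ?(ltW q0)//.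
  rewrite exprMn isqrt_sqr// ler_pdivlMr// mulrC -ler_pdivlMr ?exprn_gt0//.
  by rewrite -expr_div_n !ge_min lexx orbT.
have h1 := le_trans hA (Phi_nondecreasing cA).
have h2 : Phi (- (e * isqrt c)) <= e.
  by apply: le_trans hNA; apply: Phi_nondecreasing; rewrite lerN2.
have cvgE t := @cvg_heat_weighted_sum _ _ _ P xi W c t xi_indep xi_id
  xi_mean xi_var W_xi_indep A1 A2 c0 c1.
have /cvgrPdist_le/(_ e e0) N1 := cvgE (r - e).
have /cvgrPdist_le/(_ e e0) N2 := cvgE (r + e).
apply: (filterS2 _ _ N1 N2) => n n1 n2.
have [lo hi] := cdf_smoothing (weighted_sum_RV W xi n) r c0 (ltW e0) h1 h2.
have b1 : `|heat (r - e) (c + 1) - Phi r| <= 2 * e.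
  by apply: heat_near_Phi => //; rewrite normrN gtr0_norm.
have b2 : `|heat (r + e) (c + 1) - Phi r| <= 2 * e.
  by apply: heat_near_Phi => //; rewrite gtr0_norm.
exact: (sandwich_budget b1 b2 n1 n2 lo hi).
Qed.
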